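(* Let $\gamma>-1$, $n\ge0$, and let $\{(\xi_j,\lambda_j)\}_{j=1}^N$ be a positive cubature rule on $(V,\nu_\gamma)$ exact on $\Pi_{2n}(V)$. Let $\{(z_i,w_i)\}$ be the lifted disk rule. Let $$L_n^Vf(\xi)=\sum_{j=1}^N\lambda_jf(\xi_j)K_n^V(\xi,\xi_j),\qquad H_{2n}^BF(z)=\sum_iw_iF(z_i)K_{2n}^B(z,z_i).$$ If $f\in C(V)$ and $F=f\circ Q$, then $$(L_n^Vf)\circ Q=H_{2n}^BF,$$ and the right-hand side is even. Consequently, $$\|L_n^V\|_{C(V)\to C(V)}=\bigl\|H_{2n}^B|_{C_{\mathrm{even}}(\mathbb{B}^2)}\bigr\|_{C_{\mathrm{even}}(\mathbb{B}^2)\to C(\mathbb{B}^2)}\le\|H_{2n}^B\|_{C(\mathbb{B}^2)\to C(\mathbb{B}^2)}.$$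
   Context: $V=\{(x,y,t)\in\mathbb{R}^3:x^2+y^2=t^2,\ 0\le t\le1\}$, parametrized by $(x,y,t)=(t\cos\phi,t\sin\phi,t)$, with the probability measure $d\nu_\gamma(t,\phi)=\frac{\gamma+1}{2\pi}(1-t)^\gamma\,dt\,d\phi$ on $0\le t\le1$, $0\le\phi<2\pi$. $\mathbb{B}^2=\{(u,v)\in\mathbb{R}^2:u^2+v^2\le1\}$ carries the probability measure $d\mu_\gamma(u,v)=\frac{\gamma+1}{\pi}(1-u^2-v^2)^\gamma\,du\,dv$. The map $Q:\mathbb{B}^2\to V$ is $Q(u,v)=(u^2-v^2,\,2uv,\,u^2+v^2)$. $\Pi_m(V)$ (resp. $\Pi_m(\mathbb{B}^2)$) is the space of restrictions to $V$ (resp. $\mathbb{B}^2$) of polynomials in three (resp. two) real variables of total degree at most $m$. $K_n^V$ is the reproducing kernel of $\Pi_n(V)$ in $L^2(V,\nu_\gamma)$ and $K_m^B$ that of $\Pi_m(\mathbb{B}^2)$ in $L^2(\mathbb{B}^2,\mu_\gamma)$. A positive cubature rule has finitely many distinct nodes in $V$ and strictly positive weights; it is exact on $\Pi_{2n}(V)$ if its weighted sum equals $\int_Vp\,d\nu_\gamma$ for all $p\in\Pi_{2n}(V)$. The lifted disk rule is obtained by replacing each non-apex node $\xi_j$ by its two preimages $\pm z\in\mathbb{B}^2$ under $Q$, each with weight $\lambda_j/2$, and, if the apex $0\in V$ is a node, keeping the origin of $\mathbb{B}^2$ with the apex's weight. $C_{\mathrm{even}}(\mathbb{B}^2)$ is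 the space of continuous $F$ on $\mathbb{B}^2$ with $F(-z)=F(z)$; all $C$-spaces carry the uniform norm. *)

(* Defs.v *)
From mathcomp Require Import all_boot all_order all_algebra.
From mathcomp Require Import all_classical all_reals all_analysis.
From mathcomp Require Import -(notations) mpoly.

Set Implicit Arguments.
Unset Strict Implicit.
Unset Printing Implicit Defensive.
Import Order.TTheory GRing.Theory Num.Theory numFieldNormedType.Exports.
Local Open Scope classical_set_scope.
Local Open Scope ring_scope.

(* Functions on a set X are functions on the ambient type, only their values
   on X being relevant. *)

Section Generic.
Context {R : realType}.

Definition density_measure d (T : measurableType d) (m : set T -> \bar R)
    (D : set T) (h : T -> R) : set T -> \bar R :=
  fun A => (\int[m]_(x in D `&` A) (h x)%:E)%E.

Definition poly_space (T : Type) (X : set T) n (coord : T -> 'I_n -> R)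
    (m : nat) : set (T -> R) :=
  [set f | exists2 p : mpoly.mpoly n R, (mpoly.msize p <= m.+1)%N &
     forall x, X x -> f x = mpoly.meval (coord x) p].

(* K x y = K^~ y x; the two conditions determine K on X x X. *)
Definition reproducing_kernel d (T : measurableType d) (m : set T -> \bar R)
    (X : set T) (H : set (T -> R)) (K : T -> T -> R) : Prop :=
  forall y, X y -> H (K^~ y) /\
    forall f, H f -> f y = fine (\int[m]_(x in X) (f x * K x y)%:E)%E.

(* A rule is a sequence of (node, weight) pairs. *)
Definition positive_cubature d (T : measurableType d) (m : set T -> \bar R)
    (X : set T) (H : set (T -> R)) (rule : seq (T * R)) : Prop :=
  [/\ uniq [seq q.1 | q <- rule],
      forall q, q \in rule -> X q.1 /\ 0 < q.2 &
      forall p, H p ->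
        \sum_(q <- rule) q.2 * p q.1 = fine (\int[m]_(x in X) (p x)%:E)%E].

Definition kernel_op (T : Type) (rule : seq (T * R)) (K : T -> T -> R)
    (f : T -> R) : T -> R :=
  fun x => \sum_(q <- rule) q.2 * f q.1 * K x q.1.

Definition Cspace (T : topologicalType) (X : set T) : set (T -> R) :=
  [set f | {within X, continuous f}].

Definition uniform_norm (T : Type) (X : set T) (f : T -> R) : \bar R :=
  ereal_sup [set `|f x|%:E | x in X].

(* The norm of L : C -> C(X2), where C is a space of functions on X1. *)
Definition operator_norm (T1 T2 : Type) (C : set (T1 -> R)) (X1 : set T1)
    (X2 : set T2) (L : (T1 -> R) -> T2 -> R) : \bar R :=
  ereal_sup [set uniform_norm X2 (L f) |
               f in [set f | C f /\ (uniform_norm X1 f <= 1)%E]].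

End Generic.

Section ConeAndDisk.
Context {R : realType}.

Definition cone : set (R * R * R) :=
  [set x | x.1.1 ^+ 2 + x.1.2 ^+ 2 = x.2 ^+ 2 /\ 0 <= x.2 <= 1].

Definition disk : set (R * R) := [set z | z.1 ^+ 2 + z.2 ^+ 2 <= 1].

Definition Q (z : R * R) : R * R * R :=
  (z.1 ^+ 2 - z.2 ^+ 2, 2 * z.1 * z.2, z.1 ^+ 2 + z.2 ^+ 2).

Definition lebesgue2 : set (R * R) -> \bar R :=
  (@lebesgue_measure R \x @lebesgue_measure R)%E.

Definition cone_param (p : R * R) : R * R * R :=
  (p.1 * cos p.2, p.1 * sin p.2, p.1).

Definition nu (gamma : R) : set (R * R * R) -> \bar R :=
  pushforward
    (density_measure lebesgue2 (`[0, 1] `*` `[0, 2 * pi[)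
       (fun p => (gamma + 1) / (2 * pi) * (1 - p.1) `^ gamma))
    cone_param.

Definition mu (gamma : R) : set (R * R) -> \bar R :=
  density_measure lebesgue2 disk
    (fun z => (gamma + 1) / pi * (1 - z.1 ^+ 2 - z.2 ^+ 2) `^ gamma).

Definition PiV (m : nat) : set (R * R * R -> R) :=
  poly_space cone (fun x => tnth [tuple x.1.1; x.1.2; x.2]) m.

Definition PiB (m : nat) : set (R * R -> R) :=
  poly_space disk (fun z => tnth [tuple z.1; z.2]) m.

Definition Ceven : set (R * R -> R) :=
  [set F | Cspace disk F /\ forall z, disk z -> F (- z) = F z].

(* s chooses one preimage under Q of each node; the other one is its
   opposite. *)
Definition preimage_choice (s : R * R * R -> R * R)
    (rule : seq (R * R * R * R)) : Prop :=
  forall q, q \in rule -> disk (s q.1) /\ Q (s q.1) = q.1.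

Definition lift_node (s : R * R * R -> R * R) (q : R * R * R * R) :
    seq (R * R * R) :=
  if q.1 == 0 then [:: (0, q.2)]
  else [:: (s q.1, q.2 / 2); (- s q.1, q.2 / 2)].

Definition lifted_rule (s : R * R * R -> R * R)
    (rule : seq (R * R * R * R)) : seq (R * R * R) :=
  flatten [seq lift_node s q | q <- rule].

End ConeAndDisk.

(* Main.v *)
(** Writing [z = r e^(i a)], one has [Q z = (r^2 cos 2a, r^2 sin 2a, r^2)].
    Averaging over rotations (products of three shears, hence measure
    preserving by Fubini) and using that the push-forward of planar Lebesgue
    measure by [|z|^2] is [pi] times Lebesgue measure on the half-line, one
    gets that [Q] maps [mu gamma] to [nu gamma].  As the even polynomials of
    degree [2n] on the disk are the [f \o Q] with [f] of degree [n], the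
    reproducing property forces
    [KV (Q z) (Q w) = (KB z w + KB z (- w)) / 2], which is the operator
    identity term by term.  The norms agree because [Q] is a quotient map that
    identifies exactly [z] and [- z]. *)
From HB Require Import structures.
Require Import Defs.
From mathcomp Require Import all_boot all_order all_algebra.
From mathcomp Require Import -(notations) mpoly.
From mathcomp Require Import all_classical all_reals all_analysis.
From mathcomp Require Import measurable_realfun.
From mathcomp Require Import ring lra zify.
Set Implicit Arguments.
Unset Strict Implicit.
Import Order.TTheory GRing.Theory Num.Theory numFieldNormedType.Exports.
Local Open Scope classical_set_scope.
Local Open Scope ring_scope.

(** * Densities *)

Section Density.
Local Open Scope ereal_scope.
Context d (T : measurableType d) (R : realType).
Variables (m : {measure set T -> \bar R}) (D : set T) (h : T -> R).
Hypotheses (mD : measurable D) (mh : measurable_fun D h).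
Hypothesis h0 : forall x, (0 <= h x)%R.

Import HBNNSimple.

(** [Q] is complex squaring with the squared modulus kept as height, so its fibres are pairs of
    opposite points. No planar change of variables is used: turning [z] by [theta / 2] turns [Q z]
    by [theta], hence averaging over [theta] turns [g (Q z)] into a function of [normsq z] alone,
    and then only areas of disks matter. The half angles stay in [[0, pi[], away from the one angle
    that the shear factorization excludes. Since [mu] and [nu] are bare set functions, their measure
    structure is supplied by existence statements such as the one below. Members of the polynomial
    spaces are arbitrary off the cone or disk, so they are replaced by measurable representatives
    before integrating. The kernel identity comes from evaluating one integral in two ways, without
    orthonormal bases. It adds two integrals under [fine], hence needs [mu gamma] to have finite
    mass; this is read off the cubature rule instead of integrating [(1 - t) ^ gamma]. When the rule
    is empty, both operators are empty sums and nothing is to be shown. *)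

Lemma density_measureP : exists M : {measure set T -> \bar R},
  M = density_measure m D h :> (set T -> \bar R).
Proof.
have M0 : density_measure m D h set0 = 0.
  by rewrite /density_measure setI0 integral_set0.
have Mge0 A : 0 <= density_measure m D h A.
  by apply: integral_ge0 => x _; rewrite lee_fin.
have Msigma : semi_sigma_additive (density_measure m D h).
  move=> F mF tF mUF.
  have -> : density_measure m D h (\bigcup_n F n) =
      \sum_(i <oo) density_measure m D h (F i).
    rewrite /density_measure setI_bigcupr ge0_integral_bigcup//.
    - by move=> k; exact: measurableI.
    - apply/measurable_EFinP; apply: measurable_funS mh => //.
      by move=> x [k _ []].
    - by move=> x _; rewrite lee_fin.
    - exact: trivIset_setIl.
  exact: is_cvg_nneseries.
pose M : {measure set T -> \bar R} := HB.pack (density_measure m D h)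
  (isMeasure.Build _ _ _ (density_measure m D h) M0 Mge0 Msigma).
by exists M.
Qed.

(** By monotone convergence both sides are limits of their values on simple functions increasing to
    [f]; on an indicator the equality is the definition of [density_measure]. *)
Lemma ge0_integral_density (f : T -> \bar R) :
  measurable_fun setT f -> (forall x, 0 <= f x) ->
  \int[density_measure m D h]_x f x = \int[m]_(x in D) (f x * (h x)%:E).
Proof.
move=> mf f0; have [M ME] := density_measureP.
rewrite -ME; pose s := nnsfun_approx measurableT mf.
have s_cvg x : (EFin \o s^~ x) @ \oo --> f x by exact: cvg_nnsfun_approx.
have s_nd x a b : (a <= b)%N -> (s a x)%:E <= (s b x)%:E.
  by move=> ab; rewrite lee_fin; exact/lefP/nd_nnsfun_approx.
have mEh : measurable_fun D (EFin \o h) by exact/measurable_EFinP.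
transitivity (limn (fun n => \int[M]_x (s n x)%:E)).
  rewrite -monotone_convergence//.
  - by apply: eq_integral => x _; apply/esym/cvg_lim => //; exact: s_cvg.
  - by move=> n; exact/measurable_EFinP.
  - by move=> n x _; rewrite lee_fin.
  - by move=> x _ a b; exact: s_nd.
transitivity (limn (fun n => \int[m]_(x in D) ((s n x)%:E * (h x)%:E))); last first.
  rewrite -monotone_convergence//.
  - apply: eq_integral => x _; apply/cvg_lim => //.
    by apply: cvgeZr => //; exact: s_cvg.
  - by move=> n; apply: emeasurable_funM => //; exact/measurable_EFinP/measurable_funTS.
  - by move=> n x _; rewrite mule_ge0 ?lee_fin.
  - by move=> x _ a b ab; apply: lee_wpmul2r; rewrite ?lee_fin//; exact: s_nd.
congr (limn _); apply/funext => n.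
rewrite integral_nnsfun// patch_setT sintegralE.
transitivity (\int[m]_(x in D)
   (\sum_(y \in range (s n)) (y * \1_(s n @^-1` [set y]) x)%:E * (h x)%:E)); last first.
  apply: eq_integral => x _; rewrite -ge0_mule_fsuml => [|y]; last exact: nnfun_muleindic_ge0.
  by rewrite fsumEFin// -fimfunE.
rewrite ge0_integral_fsum//; last 2 first.
- move=> y; apply: emeasurable_funM => //; apply/measurable_EFinP/measurable_funTS.
  exact: measurable_funM.
- by move=> y x _; rewrite mule_ge0 ?nnfun_muleindic_ge0 ?lee_fin.
apply: eq_fsbigr => r /[!inE] -[t _ <-].
under eq_integral do rewrite EFinM -muleA.
rewrite ge0_integralZl//; last 3 first.
- by apply: emeasurable_funM => //; exact/measurable_EFinP/measurable_funTS.
- by move=> x _; rewrite mule_ge0 ?lee_fin.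
- by rewrite lee_fin.
congr (_ * _); rewrite ME /density_measure integral_mkcondr.
by apply: eq_integral => x _; rewrite epatch_indic/= muleC.
Qed.

End Density.

(** * Invariance of planar Lebesgue measure *)

Section Lebesgue2Measure.
Context (R : realType).
Notation lambda := (@lebesgue_measure R).
Let l2 : {measure set _ -> \bar R} := product_measure1 lambda lambda.

HB.instance Definition _ := @isMeasure.Build _ (R * R)%type R (@lebesgue2 R)
  (measure0 l2) (measure_ge0 l2) (@measure_semi_sigma_additive _ _ _ l2).

Lemma lebesgue2X (A B : set R) : measurable A -> measurable B ->
  lebesgue2 (A `*` B) = (lambda A * lambda B)%E.
Proof. by move=> mA mB; exact: (@product_measure1E _ _ _ _ R lambda lambda A B mA mB). Qed.

(** Needed to apply Tonelli to an angle and a point of the plane in [ge0_integral_lebesgue3_swap].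
    The plane is exhausted by centred squares. *)
Lemma lebesgue2_sigma_finite : sigma_finite setT (@lebesgue2 R).
Proof.
exists (fun n => `[- n%:R, n%:R]%classic `*` `[- n%:R, n%:R]%classic).
  apply/esym; rewrite -subTset => -[x y] _.
  exists (Num.truncn (`|x| + `|y|)).+1 => //=.
  have := truncnS_gt (`|x| + `|y|); set n := _.+1%:R => ltn.
  by rewrite !in_itv/= -!ler_norml; split; apply: le_trans (ltW ltn);
    rewrite ?lerDl ?lerDr.
move=> n; split; first exact: measurableX.
by rewrite lebesgue2X// lte_mul_pinfty// lebesgue_measure_itv//=;
  case: ifP => //= _; rewrite -EFinB ltry.
Qed.

HB.instance Definition _ := @Measure_isSigmaFinite.Build _ (R * R)%type R (@lebesgue2 R)
  lebesgue2_sigma_finite.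

(* [R * R] carries a default display while [lebesgue_measure] lives on
   [measurableTypeR R]: the identity transports integrals between them. *)
Lemma ge0_integral_lebesgue2E (f : (R * R)%type -> \bar R) :
  measurable_fun setT f -> (forall x, (0 <= f x)%E) ->
  (\int[lebesgue2]_z f z = \int[lambda \x lambda]_z f z)%E.
Proof.
move=> mf f0.
pose T := (measurableTypeR R * measurableTypeR R)%type.
pose phi : T -> (R * R)%type := id.
have mphi : measurable_fun setT phi by move=> _ Y mY; rewrite setTI.
exact: (@ge0_integral_pushforward _ _ T (R * R)%type R phi mphi l2 setT f
  measurableT mf (in1W f0)).
Qed.

Lemma ge0_integral_lebesgue2 (f : (R * R)%type -> \bar R) :
  measurable_fun setT f -> (forall x, (0 <= f x)%E) ->
  (\int[lebesgue2]_z f z = \int[lambda]_x \int[lambda]_y f (x, y))%E.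
Proof.
move=> mf f0; rewrite ge0_integral_lebesgue2E//.
exact: (@fubini_tonelli1 _ _ _ _ R lambda lambda f mf f0).
Qed.

Lemma ge0_integral_lebesgue2_swap (f : (R * R)%type -> \bar R) :
  measurable_fun setT f -> (forall x, (0 <= f x)%E) ->
  (\int[lebesgue2]_z f z = \int[lambda]_y \int[lambda]_x f (x, y))%E.
Proof.
move=> mf f0; rewrite ge0_integral_lebesgue2E//.
exact: (@fubini_tonelli2 _ _ _ _ R lambda lambda f mf f0).
Qed.

Lemma ge0_integral_lebesgue3_swap (f : (R * (R * R))%type -> \bar R) :
  measurable_fun setT f -> (forall x, (0 <= f x)%E) ->
  (\int[lebesgue2]_z \int[lambda]_t f (t, z) =
   \int[lambda]_t \int[lebesgue2]_z f (t, z))%E.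
Proof. by move=> mf f0; exact: (esym (@fubini_tonelli _ _ _ _ R lambda lebesgue2 f mf f0)). Qed.

End Lebesgue2Measure.

Section Lebesgue2.
Context {R : realType}.
Notation lambda := (@lebesgue_measure R).

(** Lebesgue measure is determined by the lengths of half-open intervals, and translation keeps
    lengths. *)
Lemma lebesgue_measureD (a : R) (A : set R) : measurable A ->
  pushforward lambda (fun x => x + a : measurableTypeR R) A = lambda A.
Proof.
have ma : measurable_fun setT (fun x : measurableTypeR R => x + a : measurableTypeR R).
  exact: measurable_funD.
move=> mA; apply/esym.
pose f : {mfun measurableTypeR R >-> measurableTypeR R} :=
  HB.pack (fun x : measurableTypeR R => x + a : measurableTypeR R)
    (isMeasurableFun.Build _ _ _ _ _ ma).
apply: (lebesgue_measure_unique (mu := pushforward lambda f)) => //= _ [[c d]] _ <-.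
rewrite /pushforward (_ : _ @^-1` _ = `](c - a), (d - a)]%classic); last first.
  by apply/seteqP; split => x /=; rewrite !in_itv/= ltrBlDr lerBrDr.
by rewrite !lebesgue_measure_itv/= !lte_fin ltrD2r -!EFinB opprB addrA subrK.
Qed.

Lemma ge0_integral_shift (a : R) (f : R -> \bar R) :
  measurable_fun setT f -> (forall x, (0 <= f x)%E) ->
  (\int[lambda]_x f (x + a)%R = \int[lambda]_x f x)%E.
Proof.
move=> mf f0.
have ma : measurable_fun setT (fun x : R => x + a : measurableTypeR R) by exact: measurable_funD.
transitivity (\int[pushforward lambda (fun x => (x + a)%R : measurableTypeR R)]_x f x)%E.
  by rewrite ge0_integral_pushforward// preimage_setT.
by apply: eq_measure_integral => A mA _; exact: lebesgue_measureD.
Qed.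

(** Invariance is phrased through nonnegative integrals, the form in which it is applied;
    measurability is carried along so that such maps compose. *)
Definition preserves_lebesgue2 (phi : R * R -> R * R) :=
  measurable_fun setT phi /\
  forall f : R * R -> \bar R, measurable_fun setT f -> (forall x, (0 <= f x)%E) ->
  (\int[lebesgue2]_z f (phi z) = \int[lebesgue2]_z f z)%E.

Lemma preserves_lebesgue2_comp phi psi : preserves_lebesgue2 phi -> preserves_lebesgue2 psi ->
  preserves_lebesgue2 (phi \o psi).
Proof.
move=> [mphi iphi] [mpsi ipsi]; split; first exact: measurableT_comp.
move=> f mf f0; transitivity (\int[lebesgue2]_z f (phi z))%E; last exact: iphi.
by apply: (ipsi (f \o phi)); [exact: (measurableT_comp mf mphi)|move=> x; exact: f0].
Qed.

(** With [y] fixed the shear is a translation by [c * y], so the variable [x] is integrated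
    first. *)
Lemma preserves_lebesgue2_shear1 c : preserves_lebesgue2 (fun z => (z.1 + c * z.2, z.2)).
Proof.
have m : measurable_fun setT (fun z : R * R => (z.1 + c * z.2, z.2)).
  by apply: measurable_fun_pair => //; apply: measurable_funD => //; apply: measurable_funM.
split=> // f mf f0; rewrite ge0_integral_lebesgue2_swap//; last exact: (measurableT_comp mf m).
rewrite [RHS](ge0_integral_lebesgue2_swap mf f0); apply: eq_integral => y _.
apply: (@ge0_integral_shift (c * y) (fun x => f (x, y))) => //.
exact: (measurableT_comp mf (measurable_pair2 y)).
Qed.

Lemma preserves_lebesgue2_shear2 c : preserves_lebesgue2 (fun z => (z.1, z.2 + c * z.1)).
Proof.
have m : measurable_fun setT (fun z : R * R => (z.1, z.2 + c * z.1)).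
  by apply: measurable_fun_pair => //; apply: measurable_funD => //; apply: measurable_funM.
split=> // f mf f0; rewrite ge0_integral_lebesgue2//; last exact: (measurableT_comp mf m).
rewrite [RHS](ge0_integral_lebesgue2 mf f0); apply: eq_integral => y _.
apply: (@ge0_integral_shift (c * y) (fun x => f (y, x))) => //.
exact: (measurableT_comp mf (measurable_pair1 y)).
Qed.

Definition rotation (c s : R) (z : R * R) : R * R :=
  (c * z.1 - s * z.2, s * z.1 + c * z.2).

(* A rotation by an angle other than [pi] is a product of three shears. *)
Lemma preserves_lebesgue2_rotation c s : c ^+ 2 + s ^+ 2 = 1 -> c != -1 ->
  preserves_lebesgue2 (rotation c s).
Proof.
move=> cs c1; have c1' : 1 + c != 0 by rewrite addrC addr_eq0.
(* [t] is minus the tangent of half the rotation angle. The product of the shears with coefficients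
   [t], [s], [t] is the rotation exactly when [1 + t * s = c] and [t * (1 + c) = - s]. *)
set t := - (s / (1 + c)).
have ts : 1 + t * s = c.
  rewrite /t; apply: (mulfI c1'); rewrite mulrDr mulNr mulrAC mulrN.
  by rewrite (mulrC (1 + c) (_ / _)) mulfVK//; nra.
have tc : t * (1 + c) = - s by rewrite /t mulNr mulfVK.
rewrite (_ : rotation c s = (fun z => (z.1 + t * z.2, z.2)) \o
  ((fun z => (z.1, z.2 + s * z.1)) \o (fun z => (z.1 + t * z.2, z.2)))).
  by do 2?apply: preserves_lebesgue2_comp; [exact: preserves_lebesgue2_shear1|
    exact: preserves_lebesgue2_shear2|exact: preserves_lebesgue2_shear1].
apply/funext => -[x y]; rewrite /rotation /=; congr pair;
  apply/eqP; rewrite -subr_eq0; apply/eqP.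
  transitivity ((c - (1 + t * s)) * (x + t * y) - (t * (1 + c) + s) * y); first by ring.
  by rewrite ts tc subrr mul0r addNr mul0r subrr.
transitivity ((c - (1 + t * s)) * y); first by ring.
by rewrite ts subrr mul0r.
Qed.

(** The half turn is the excluded angle of the preceding lemma, so it is taken as two quarter
    turns. *)
Lemma preserves_lebesgue2_opp : preserves_lebesgue2 -%R.
Proof.
have r : preserves_lebesgue2 (rotation 0 1).
  by apply: preserves_lebesgue2_rotation; rewrite ?expr0n ?expr1n ?add0r// eq_sym oppr_eq0 oner_eq0.
rewrite (_ : -%R = rotation 0 1 \o rotation 0 1); first exact: preserves_lebesgue2_comp.
apply/funext => -[x y]; rewrite /rotation /=; transitivity (- x, - y) => //.
by congr pair; ring.
Qed.

End Lebesgue2.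

(** * Polar coordinates *)

Section Radial.
Context {R : realType}.
Notation lambda := (@lebesgue_measure R).

(** [Num.sqrt] is 0 on negative reals, so one formula also covers the empty set. *)
Lemma lebesgue_measure_sqr_le (c : R) :
  lambda [set y | y ^+ 2 <= c] = (2 * Num.sqrt c)%:E.
Proof.
have [c0|c0] := ltP c 0.
  rewrite (_ : mkset _ = set0) ?measure0 ?ltr0_sqrtr ?mulr0//.
  by apply/seteqP; split => y //= yc; have := sqr_ge0 y; lra.
rewrite (_ : mkset _ = `[- Num.sqrt c, Num.sqrt c]%classic); last first.
  apply/seteqP; split => y /=; rewrite in_itv/= -ler_norml -[`|y| <= _]ler_sqr ?nnegrE ?sqrtr_ge0//;
    rewrite real_normK ?num_real// sqr_sqrtr//.
rewrite lebesgue_measure_itv/= lte_fin.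
have [s0|s0] := eqVneq (Num.sqrt c) 0; first by rewrite s0 oppr0 ltxx mulr0.
have s1 : 0 < Num.sqrt c by rewrite lt_def s0 sqrtr_ge0.
by rewrite ifT -?EFinB; [congr _%:E; ring|lra].
Qed.

(** Area of a disk of radius [Num.sqrt b], summed over its vertical chords. The substitution is
    [x = Num.sqrt b * sin t] on [[- pi / 2, pi / 2]]. *)
Lemma integral_semicircle (b : R) : 0 < b ->
  (\int[lambda]_(x in `[(- Num.sqrt b)%R, Num.sqrt b])
     (2 * Num.sqrt (b - x ^+ 2))%:E = (b * pi)%:E)%E.
Proof.
move=> b0; have r0 : 0 < Num.sqrt b by rewrite sqrtr_gt0.
have hpi : 0 < pi / 2 :> R by rewrite divr_gt0 ?pi_gt0.
pose F : R -> R := fun t => Num.sqrt b * sin t.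
have dF (t : R) : is_derive t (1 : R) F (Num.sqrt b * cos t).
  by rewrite /F; apply: is_derive_eq; rewrite /GRing.scale/= mulrC ?mulr0 ?addr0.
have F'E : derive1 F = (fun t => Num.sqrt b * cos t).
  by apply/funext => t; rewrite derive1E; apply: derive_val.
have cF' : continuous (derive1 F).
  by rewrite F'E => t; apply: cvgM; [exact: cvg_cst|exact: continuous_cos].
have dF1 (t : R) : derivable F t 1 by case: (dF t).
have cF : continuous F by move=> t; apply: differentiable_continuous; apply/derivable1_diffP.
have Fa : F (- (pi / 2)) = - Num.sqrt b by rewrite /F sinN sin_pihalf mulrN mulr1.
have Fb : F (pi / 2) = Num.sqrt b by rewrite /F sin_pihalf mulr1.
rewrite -Fa -Fb (@integration_by_substitution_increasing R F
  (fun x => 2 * Num.sqrt (b - x ^+ 2))); last 7 first.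
- lra.
- by move=> x y xp yp xy; rewrite /F ltr_pM2l// ltr_sin.
- by move=> t _; exact: cF'.
- by apply/cvg_ex; eexists; apply: cvg_at_right_filter; exact: cF'.
- by apply/cvg_ex; eexists; apply: cvg_at_left_filter; exact: cF'.
- split; first by move=> t _; exact: dF1.
    by apply: cvg_at_right_filter; exact: cF.
  by apply: cvg_at_left_filter; exact: cF.
- have cg : continuous (fun x : R => b - x ^+ 2).
    by move=> x; apply: cvgB; [exact: cvg_cst|exact: exprn_continuous].
  apply: continuous_subspaceT => x; apply: cvgM; first exact: cvg_cst.
  exact: (continuous_comp (cg x) (@sqrt_continuous R _)).
(* Antiderivative of [2 * b * cos t ^+ 2], as [1 + cos t ^+ 2 - sin t ^+ 2 = 2 * cos t ^+ 2]. *)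
pose G : R -> R := fun t => b * (t + sin t * cos t).
have dG (t : R) : is_derive t (1 : R) G (2 * b * cos t ^+ 2).
  rewrite /G; apply: is_derive_eq; rewrite /GRing.scale/=.
  have -> : sin t * - sin t = cos t ^+ 2 - 1 by rewrite cos2sin2; ring.
  by ring.
transitivity (\int[lambda]_(t in `[(- (pi / 2))%R, (pi / 2)%R])
    (2 * b * cos t ^+ 2)%:E)%E.
  apply: eq_integral.
  move=> t; rewrite inE/= in_itv/= => tp; rewrite F'E.
  rewrite [LHS](_ : _ = (2 * Num.sqrt (b - (Num.sqrt b * sin t) ^+ 2) *
    (Num.sqrt b * cos t))%:E)// exprMn sqr_sqrtr ?(ltW b0)//.
  rewrite (_ : b - b * sin t ^+ 2 = b * cos t ^+ 2); last by rewrite cos2sin2; ring.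
  rewrite sqrtrM ?(ltW b0)// sqrtr_sqr ger0_norm ?cos_ge0_pihalf//.
  by congr _%:E; rewrite -{3}(sqr_sqrtr (ltW b0)); ring.
rewrite (@continuous_FTC2 R _ G); first 1 last.
- lra.
- apply: continuous_subspaceT => t; apply: cvgM; first exact: cvg_cst.
  exact: (cvgM (@continuous_cos R t) (@continuous_cos R t)).
- have cG : continuous G.
    by move=> t; apply: differentiable_continuous; apply/derivable1_diffP; case: (dG t).
  split; first by move=> t _; case: (dG t).
    by apply: cvg_at_right_filter; exact: cG.
  by apply: cvg_at_left_filter; exact: cG.
- by move=> t _; rewrite derive1E; apply: derive_val.
by rewrite -EFinB /G cosN cos_pihalf; congr _%:E; field.
Qed.
Definition normsq (z : R * R) : R := z.1 ^+ 2 + z.2 ^+ 2.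

Lemma measurable_normsq : measurable_fun setT normsq.
Proof. by apply: measurable_funD; apply: measurable_funX. Qed.

Lemma lebesgue2_normsq_le (b : R) :
  lebesgue2 [set z | normsq z <= b] = (pi * Num.max 0 b)%:E.
Proof.
transitivity (\int[lambda]_x (2 * Num.sqrt (b - x ^+ 2))%:E)%E.
  apply: eq_integral => x _; rewrite -lebesgue_measure_sqr_le; congr (lambda _).
  by rewrite xsectionE; apply/seteqP; split => y; rewrite /normsq/= lerBrDl.
have [b0|b0] := ltP 0 b; last first.
  rewrite mulr0 integral0_eq// => x _; rewrite ler0_sqrtr ?mulr0//.
  by rewrite subr_le0 (le_trans b0) ?sqr_ge0.
rewrite mulrC -integral_semicircle// [RHS]integral_mkcond; apply: eq_integral => x _.
rewrite patchE; case: ifPn => //; rewrite notin_setE/= in_itv/= -ler_norml => /negP.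
rewrite -ltNge -ltr_sqr ?nnegrE ?sqrtr_ge0// real_normK ?num_real// sqr_sqrtr ?(ltW b0)// => bx.
by rewrite ler0_sqrtr ?mulr0// subr_le0 ltW.
Qed.

(** Measures on the line are compared on intervals []a, b]], whose preimages are annuli, that is,
    differences of two disks of known area. *)
Lemma lebesgue2_normsq (A : set R) : measurable A -> A `<=` `[0, +oo[ ->
  lebesgue2 (normsq @^-1` A) = (pi%:E * lambda A)%E.
Proof.
pose mR := measurableTypeR R.
have mN : measurable_fun setT (normsq : _ -> mR) by exact: measurable_normsq.
have [P PE] : exists P : {measure set mR -> \bar R},
    forall X, P X = lebesgue2 (normsq @^-1` X).
  by unshelve refine (ex_intro _
    (pushforward lebesgue2 (normsq : _ -> mR) : {measure set mR -> \bar R}) _).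
have ipi0 : 0 <= pi^-1 :> R by rewrite invr_ge0 pi_ge0.
have mneg : measurable (`]-oo, (0 : R)[%classic : set mR) by [].
(* The image under [normsq] does not charge the negative half-line. Adding Lebesgue measure there
   gives a measure [M] that can agree with [lambda] on every interval, as the uniqueness theorem
   requires; the addition vanishes on [A]. *)
pose L : {measure set mR -> \bar R} := mrestr lambda mneg.
pose M : {measure set mR -> \bar R} := measure_add (mscale (NngNum ipi0) P) L.
have ME X : M X = ((pi^-1)%:E * P X + lambda (X `&` `]-oo, 0%R[%classic))%E.
  exact: measure_addE.
have key X : ocitv X -> lambda X = M X.
  move=> [[a b]] _ <- /=; rewrite ME PE.
  have mD c : measurable [set z | normsq z <= c].
    rewrite (_ : mkset _ = setT `&` normsq @^-1` `]-oo, c]).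
      by apply: measurable_normsq => //; exact: measurable_itv.
    by rewrite setTI; apply/seteqP; split => z /=; rewrite in_itv.
  have [ab|ba] := leP a b; last first.
    rewrite set_itv_ge ?bnd_simp -?leNgt ?(ltW ba)// preimage_set0 set0I.
    by rewrite !measure0 mule0 add0e.
  rewrite (_ : normsq @^-1` _ = [set z | normsq z <= b] `\` [set z | normsq z <= a]); last first.
    apply/seteqP; split => z /=; rewrite in_itv/= ltNge.
      by move=> /andP[/negP].
    by move=> [-> /negP ->].
  rewrite [lebesgue2 _](measureD (mD b) (mD a)) /=; last by rewrite /= lebesgue2_normsq_le ltry.
  rewrite setIidr; last by move=> z /= /le_trans; exact.
  rewrite !lebesgue2_normsq_le -EFinB -EFinM -mulrBr mulKf ?gt_eqF ?pi_gt0//.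
  have [a0|a0] := leP 0 a.
    rewrite (_ : `]a, b] `&` _ = set0) ?measure0 ?adde0; last first.
      by apply/seteqP; split => // x /=; rewrite !in_itv/=; lra.
    rewrite lebesgue_measure_itv/= lte_fin.
    rewrite !(max_idPr _) ?(le_trans a0 ab)//.
    by case: ltP => // /(conj ab)/andP; rewrite -eq_le => /eqP ->; rewrite subrr.
  have [b0|b0] := ltP b 0.
    rewrite setIidl; last by move=> x /=; rewrite !in_itv/=; lra.
    by rewrite subr0 add0e.
  rewrite (_ : `]a, b] `&` _ = `]a, 0[%classic); last first.
    by apply/seteqP; split => // x /=; rewrite !in_itv/=; lra.
  rewrite !lebesgue_measure_itv/= !lte_fin a0 (lt_le_trans a0 b0).
  by rewrite -!EFinB -EFinD; congr _%:E; lra.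
move=> mA A0; have -> : lambda A = M A by exact: lebesgue_measure_unique.
rewrite ME (_ : A `&` _ = set0) ?measure0 ?adde0; last first.
  by apply/seteqP; split => // x [/A0]/=; rewrite !in_itv/=; lra.
by rewrite muleA -EFinM divff ?mul1e// gt_eqF ?pi_gt0.
Qed.

Lemma ge0_integral_normsq (f : R -> \bar R) :
  measurable_fun setT f -> (forall x, (0 <= f x)%E) ->
  (\int[lebesgue2]_z f (normsq z) = pi%:E * \int[lambda]_(t in `[0%R, +oo[) f t)%E.
Proof.
move=> mf f0.
pose mR := measurableTypeR R.
have mN : measurable_fun setT (normsq : _ -> mR) by exact: measurable_normsq.
have mD : measurable (`[0, +oo[%classic : set mR) by [].
have mfD : measurable_fun (`[0, +oo[%classic : set mR) f by exact: measurable_funS mf.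
transitivity (\int[pushforward lebesgue2 (normsq : _ -> mR)]_(t in `[0%R, +oo[) f t)%E.
  rewrite ge0_integral_pushforward//; congr (integral _ _ _).
  by apply/seteqP; split => // z _ /=; rewrite in_itv/= andbT addr_ge0 ?sqr_ge0.
rewrite -(ge0_integral_mscale _ mD (NngNum (@pi_ge0 R)))//.
by apply: eq_measure_integral => A mA /(lebesgue2_normsq mA).
Qed.
End Radial.

(** * Integration of functions of [Q z] by height and angle *)

Section Polar.
Context {R : realType}.
Notation lambda := (@lebesgue_measure R).

Lemma ge0_integral_shift_itv (a c d : R) (g : R -> \bar R) :
  measurable_fun setT g -> (forall x, (0 <= g x)%E) ->
  (\int[lambda]_(x in `[c, d[) g (x + a)%R =
   \int[lambda]_(x in `[(c + a)%R, (d + a)%R[) g x)%E.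
Proof.
move=> mg g0; rewrite integral_mkcond [RHS]integral_mkcond.
rewrite -[RHS](ge0_integral_shift a); last 2 first.
- apply/(measurable_restrictT _ _).1 => //; exact: measurable_funS mg.
- by move=> x; apply: erestrict_ge0.
apply: eq_integral => x _; rewrite !patchE.
by rewrite (_ : (x + a \in `[(c + a)%R, (d + a)%R[%classic) = (x \in `[c, d[%classic))//
  !mem_setE !in_itv/= lerD2r ltrD2r.
Qed.

(** The shift moves the window to [[a, p + a[]; it is cut at [p] and the overhang [[p, p + a[] is
    brought back by one period. *)
Lemma ge0_integral_periodic (p a : R) (g : R -> \bar R) :
  0 <= a <= p -> (forall x, g (x + p) = g x) ->
  measurable_fun setT g -> (forall x, (0 <= g x)%E) ->
  (\int[lambda]_(x in `[0%R, p[) g (x + a)%R = \int[lambda]_(x in `[0%R, p[) g x)%E.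
Proof.
move=> /andP[a0 ap] gp mg g0; have mgS (D : set R) : measurable D -> measurable_fun D g.
  by move=> mD; exact: measurable_funS mg.
have split (x y z : R) : x <= y -> y <= z ->
    (\int[lambda]_(t in `[x, z[) g t =
     \int[lambda]_(t in `[x, y[) g t + \int[lambda]_(t in `[y, z[) g t)%E.
  move=> xy yz; rewrite -ge0_integral_setU//=.
  - by rewrite -itv_bndbnd_setU// bnd_simp.
  - by apply: mgS; exact: measurableU.
  - apply/disj_setPS => t [] /=; rewrite !in_itv/= => /andP[_ ty] /andP[yt _].
    by move: (lt_le_trans ty yt); rewrite ltxx.
have E : (\int[lambda]_(t in `[p, (p + a)%R[) g t = \int[lambda]_(t in `[0%R, a[) g t)%E.
  rewrite -[in LHS](add0r p) -[X in `[_, X[%classic](addrC a) add0r.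
  have := ge0_integral_shift_itv p 0 a mg g0; rewrite add0r => <-.
  by apply: eq_integral => t _; rewrite gp.
rewrite ge0_integral_shift_itv// add0r (split a p)//; last by rewrite lerDl.
by rewrite E addeC -split.
Qed.

(** [acos (x / t)] has the right cosine and a nonnegative sine; for [y < 0] its reflection
    [2 * pi - acos (x / t)] is taken. *)
Lemma polar_angle (x y t : R) : 0 <= t -> x ^+ 2 + y ^+ 2 = t ^+ 2 ->
  exists2 phi, 0 <= phi <= 2 * pi & x = t * cos phi /\ y = t * sin phi.
Proof.
rewrite le_eqVlt => /predU1P[<-|t0 xyt].
  rewrite expr0n/= => /eqP; rewrite paddr_eq0 ?sqr_ge0// !sqrf_eq0 => /andP[/eqP-> /eqP->].
  by exists 0; rewrite ?mul0r// lexx mulr_ge0// pi_ge0.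
have tn0 : t != 0 by rewrite gt_eqF.
have xt1 : -1 <= x / t <= 1.
  rewrite -ler_norml normrM normfV (gtr0_norm t0) ler_pdivrMr// mul1r.
  rewrite -ler_sqr ?nnegrE ?(ltW t0)// real_normK ?num_real//.
  by rewrite -xyt lerDl sqr_ge0.
have xE : t * cos (acos (x / t)) = x.
  by rewrite acosK ?in_itv//= mulrC mulfVK.
have yE : t * sin (acos (x / t)) = `|y|.
  rewrite sin_acos// -{1}(gtr0_norm t0) -sqrtr_sqr -sqrtrM ?sqr_ge0//.
  rewrite mulrBr mulr1 expr_div_n mulrCA divff ?expf_neq0// mulr1.
  by rewrite -xyt addrAC subrr add0r sqrtr_sqr.
have := acos_ge0 xt1; have := acos_lepi xt1; have := @pi_ge0 R => pi0 api a0.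
have [y0|y0] := leP 0 y.
  by exists (acos (x / t)); [lra|split; rewrite ?xE// yE ger0_norm].
exists (2 * pi - acos (x / t)); first lra.
have -> : 2 * pi - acos (x / t) = - acos (x / t) + pi *+ 2 by rewrite mulr_natl addrC.
by rewrite cosD2pi sinD2pi cosN sinN mulrN xE yE ltr0_norm// opprK.
Qed.

(** Squaring a complex number doubles its argument. *)
Lemma Q_rotation (z : R * R) (phi theta : R) :
  Q z = cone_param (normsq z, phi) ->
  Q (rotation (cos (theta / 2)) (sin (theta / 2)) z) =
  cone_param (normsq z, theta + phi).
Proof.
case: z => u v; rewrite /Q/cone_param/normsq/rotation/= => -[X Y].
have cs := cos2Dsin2 (theta / 2).
have th : theta = theta / 2 + theta / 2 by field.
congr (_, _, _).
- rewrite cosD [RHS]mulrBr !(mulrCA (u ^+ 2 + v ^+ 2)) -X -Y [in RHS]th cosD sinD; ring.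
- rewrite sinD [RHS]mulrDr !(mulrCA (u ^+ 2 + v ^+ 2)) -X -Y [in RHS]th cosD sinD; ring.
- transitivity ((cos (theta / 2) ^+ 2 + sin (theta / 2) ^+ 2) * (u ^+ 2 + v ^+ 2)).
    by ring.
  by rewrite cs mul1r.
Qed.

Lemma Q_angle (z : R * R) : exists2 phi, 0 <= phi <= 2 * pi &
  Q z = cone_param (normsq z, phi).
Proof.
have [||phi hphi [X Y]] := @polar_angle (z.1 ^+ 2 - z.2 ^+ 2) (2 * z.1 * z.2) (normsq z).
- by rewrite addr_ge0 ?sqr_ge0.
- by rewrite /normsq; ring.
by exists phi => //; rewrite /Q X Y.
Qed.

Lemma measurable_Q : measurable_fun setT (@Q R).
Proof.
apply: measurable_fun_pair; last exact: measurable_normsq.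
apply: measurable_fun_pair.
  by apply: measurable_funB; apply: measurable_funX.
by do 2?apply: measurable_funM.
Qed.

Lemma measurable_cone_param : measurable_fun setT (@cone_param R).
Proof.
have mcos : measurable_fun setT (fun p : R * R => cos p.2).
  by apply: measurableT_comp => //; apply: continuous_measurable_fun; exact: continuous_cos.
have msin : measurable_fun setT (fun p : R * R => sin p.2).
  by apply: measurableT_comp => //; apply: continuous_measurable_fun; exact: continuous_sin.
by apply: measurable_fun_pair => //; apply: measurable_fun_pair; apply: measurable_funM.
Qed.

Section ge0_integral_Q.
Variable g : R * R * R -> \bar R.
Hypotheses (mg : measurable_fun setT g) (g0 : forall x, (0 <= g x)%E).

Let angular (t : R) := (\int[lambda]_(phi in `[0%R, (2 * pi)%R[) g (cone_param (t, phi)))%E.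

Lemma measurable_cone_param_restrict :
  measurable_fun setT ((g \o cone_param) \_ (setT `*` `[0, 2 * pi[)).
Proof.
apply/(measurable_restrictT _ _).1; first exact: measurableX.
apply: measurable_funS (measurableT_comp mg measurable_cone_param) => //.
Qed.

Lemma angularE t : angular t =
  (\int[lambda]_phi ((g \o cone_param) \_ (setT `*` `[0%R, (2 * pi)%R[)) (t, phi))%E.
Proof.
rewrite /angular integral_mkcond; apply: eq_integral => phi _; rewrite !patchE.
by congr (if _ then _ else _); apply/idP/idP; rewrite !inE /= => // -[].
Qed.

Lemma measurable_angular : measurable_fun setT angular.
Proof.
rewrite (_ : angular = fubini_F lambda ((g \o cone_param) \_ (setT `*` `[0, 2 * pi[))).
  apply: measurable_fun_fubini_tonelli_F; first exact: measurable_cone_param_restrict.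
  by move=> p; apply: erestrict_ge0 => ? _ /=.
by apply/funext => t; exact: angularE.
Qed.

(** The integral of [g (Q (rot (theta, z)))] over [theta] in [[0, 2 * pi[] and [z] in the plane is
    computed in both orders: rotation invariance gives [2 * pi] times the left side, the angular
    average gives [pi] times the integral of [angular]. Their quotient is the factor 1/2. *)
Lemma ge0_integral_Q :
  (\int[lebesgue2]_z g (Q z) = 2^-1%:E * \int[lambda]_(t in `[0%R, +oo[) angular t)%E.
Proof.
have ppi := @pi_gt0 R.
pose D := `[0, 2 * pi[%classic : set R.
pose rot (p : R * (R * R)) := rotation (cos (p.1 / 2)) (sin (p.1 / 2)) p.2.
pose H := (g \o @Q R \o rot) \_ (D `*` setT).
have mhalf : measurable_fun setT (fun p : R * (R * R) => p.1 / 2) by exact: measurable_funM.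
have mc : measurable_fun setT (fun p : R * (R * R) => cos (p.1 / 2)).
  by apply: measurableT_comp mhalf; apply: continuous_measurable_fun; exact: continuous_cos.
have ms : measurable_fun setT (fun p : R * (R * R) => sin (p.1 / 2)).
  by apply: measurableT_comp mhalf; apply: continuous_measurable_fun; exact: continuous_sin.
have mz1 : measurable_fun setT (fun p : R * (R * R) => p.2.1) by exact: measurableT_comp.
have mz2 : measurable_fun setT (fun p : R * (R * R) => p.2.2) by exact: measurableT_comp.
have mrot : measurable_fun setT rot.
  by apply: measurable_fun_pair; [apply: measurable_funB|apply: measurable_funD];
    exact: measurable_funM.
have mH : measurable_fun setT H.
  apply/(measurable_restrictT _ _).1; first by apply: measurableX => //; exact: measurable_itv.
  by apply: measurable_funS (measurableT_comp mg (measurableT_comp measurable_Q mrot)).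
have H0 p : (0 <= H p)%E by apply: erestrict_ge0 => ? _ /=.
set I := LHS.
have IE : (\int[lambda]_theta \int[lebesgue2]_z H (theta, z) = I * (2 * pi)%:E)%E.
  transitivity (\int[lambda]_(theta in D) cst I theta)%E.
    rewrite [RHS]integral_mkcond; apply: eq_integral => theta _; rewrite patchE.
    case: ifPn => [|thD]; last first.
      rewrite integral0_eq// => z _; rewrite /H patchE ifF//.
      by apply: contraNF thD; rewrite !inE => -[].
    rewrite inE /D/= in_itv/= => /andP[th0 th2].
    have [_ rotE] : preserves_lebesgue2 (rotation (cos (theta / 2)) (sin (theta / 2))).
      apply: preserves_lebesgue2_rotation; first exact: cos2Dsin2.
      (* As [theta < 2 * pi], the half angle is below [pi] and its cosine differs from -1. *)
      have : cos pi < cos (theta / 2) by rewrite ltr_cos ?in_itv/=; lra.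
      by rewrite cospi => /gt_eqF ->.
    rewrite -[RHS](rotE (g \o @Q R) (measurableT_comp mg measurable_Q) (fun z => g0 _)).
    apply: eq_integral => z _; rewrite /H patchE ifT//.
    by rewrite inE; split => //=; rewrite /D/= in_itv/= th0.
  rewrite integral_cst//; last exact: measurable_itv.
  congr (I * _)%E; transitivity (lambda D) => //.
  by rewrite /D lebesgue_measure_itv/= lte_fin mulr_gt0// -EFinB subr0.
have IE' : (\int[lebesgue2]_z \int[lambda]_theta H (theta, z) =
    pi%:E * \int[lambda]_(t in `[0%R, +oo[) angular t)%E.
  have ang0 t : (0 <= angular t)%E by apply: integral_ge0.
  rewrite -(ge0_integral_normsq measurable_angular ang0).
  (* For fixed [z] the angle of [Q z] is some unknown [a]; integrating over a full period makes it
     disappear. *)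
  apply: eq_integral => z _; have [a ha Qz] := Q_angle z.
  transitivity (\int[lambda]_(theta in `[0%R, (2 * pi)%R[)
      g (cone_param (normsq z, (theta + a)%R)))%E.
    rewrite [RHS]integral_mkcond; apply: eq_integral => theta _.
    rewrite /H !patchE /= (Q_rotation _ Qz).
    by congr (if _ then _ else _); apply/idP/idP; rewrite !inE /= => // -[].
  apply: (ge0_integral_periodic (g := fun phi => g (cone_param (normsq z, phi)))) => //.
    by move=> phi; rewrite /cone_param/= mulr_natl cosD2pi sinD2pi.
  exact: (measurableT_comp mg (measurableT_comp measurable_cone_param (measurable_pair1 _))).
have := IE; rewrite -ge0_integral_lebesgue3_swap// IE' => E.
(* [I] may be infinite, so division by [2 * pi] is written as multiplication by a finite inverse. *)
rewrite -[LHS]mule1 (_ : 1%E = (2 * pi)%:E * (2 * pi)^-1%:E)%E; last first.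
  by rewrite -EFinM divff// gt_eqF// mulr_gt0.
rewrite muleA -E muleAC -EFinM; congr (_%:E * _)%E.
by rewrite invfM mulrCA divff ?mulr1// gt_eqF.
Qed.
End ge0_integral_Q.

End Polar.

(** * The cone measure as an image of the disk measure *)

Section ConeDisk.
Context {R : realType}.
Notation lambda := (@lebesgue_measure R).
Implicit Types z : R * R.

Lemma cone_Q z : cone (Q z) <-> disk z.
Proof.
rewrite /cone/disk/Q/=; split=> [[_ /andP[]]//|z1].
by split; [ring|rewrite z1 addr_ge0 ?sqr_ge0].
Qed.

Lemma measurable_disk : measurable (@disk R).
Proof.
rewrite (_ : disk = setT `&` normsq @^-1` `]-oo, 1]).
  by apply: measurable_normsq => //; exact: measurable_itv.
by rewrite setTI; apply/seteqP; split => z /=; rewrite in_itv.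
Qed.

Lemma measurable_cone : measurable (@cone R).
Proof.
have m1 : measurable_fun setT (fun x : R * R * R => x.1.1 ^+ 2 + x.1.2 ^+ 2 - x.2 ^+ 2).
  have m11 : measurable_fun setT (fun x : R * R * R => x.1.1) by exact: measurableT_comp.
  have m12 : measurable_fun setT (fun x : R * R * R => x.1.2) by exact: measurableT_comp.
  by apply: measurable_funB; [apply: measurable_funD|]; apply: measurable_funX.
have m2 : measurable_fun setT (fun x : R * R * R => x.2) by exact: measurable_snd.
rewrite (_ : cone =
  (setT `&` (fun x : R * R * R => x.1.1 ^+ 2 + x.1.2 ^+ 2 - x.2 ^+ 2) @^-1` [set 0])
  `&` (setT `&` (fun x : R * R * R => x.2) @^-1` `[0, 1])).
  apply: measurableI; first by apply: m1 => //; exact: measurable_set1.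
  by apply: m2 => //; exact: measurable_itv.
rewrite !setTI; apply/seteqP; split => x /=; rewrite in_itv/=.
  by move=> [-> ->]; rewrite subrr.
by move=> [/eqP + ?]; rewrite subr_eq0 => /eqP.
Qed.

Section gamma.
Variable gamma : R.
Hypothesis gamma1 : -1 < gamma.

Definition cone_density (t : R) := (gamma + 1) / (2 * pi) * (1 - t) `^ gamma.

Lemma cone_density_ge0 t : 0 <= cone_density t.
Proof.
rewrite mulr_ge0 ?powR_ge0// divr_ge0 ?mulr_ge0 ?pi_ge0//.
by have := gamma1; lra.
Qed.

Lemma measurable_cone_density : measurable_fun setT cone_density.
Proof.
apply: measurable_funM => //; apply: (measurableT_comp (@measurable_powR R gamma)).
exact: measurable_funB.
Qed.

#[local] Hint Resolve cone_density_ge0 measurable_cone_density : core.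

Let disk_density_ge0 z :
  0 <= (gamma + 1) / pi * (1 - z.1 ^+ 2 - z.2 ^+ 2) `^ gamma.
Proof.
by rewrite mulr_ge0 ?powR_ge0// divr_ge0 ?pi_ge0//; have := gamma1; lra.
Qed.

(** [normsq z] is the height of [Q z], so the disk density is a function on the cone. The factor 2
    will cancel the 1/2 of [ge0_integral_Q]. *)
Let disk_densityE z : (gamma + 1) / pi * (1 - z.1 ^+ 2 - z.2 ^+ 2) `^ gamma =
  2 * cone_density (normsq z).
Proof.
rewrite /cone_density /normsq opprD addrA mulrA; congr (_ * _).
by rewrite mulrCA invfM mulVKf.
Qed.

Let measurable_disk_density : measurable_fun disk
  (fun z => (gamma + 1) / pi * (1 - z.1 ^+ 2 - z.2 ^+ 2) `^ gamma).
Proof.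
under eq_fun do rewrite disk_densityE.
apply: measurable_funTS; apply: measurable_funM => //.
exact: (measurableT_comp measurable_cone_density measurable_normsq).
Qed.

Lemma mu_measure : exists M : {measure set (R * R)%type -> \bar R},
  M = mu gamma :> (set (R * R) -> \bar R).
Proof. exact: density_measureP measurable_disk _ _. Qed.

Lemma ge0_integral_mu (f : R * R -> \bar R) :
  measurable_fun setT f -> (forall z, (0 <= f z)%E) ->
  (\int[mu gamma]_z f z =
   \int[lebesgue2]_(z in disk) (f z * (2 * cone_density (normsq z))%:E))%E.
Proof.
move=> mf f0; rewrite ge0_integral_density//; last exact: measurable_disk.
by apply: eq_integral => z _; rewrite disk_densityE.
Qed.

Let D : set (R * R) := `[0, 1] `*` `[0, 2 * pi[.

Let mD : measurable D. Proof. exact: measurableX. Qed.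

Let measurable_cone_density1 : measurable_fun D (fun p : R * R => cone_density p.1).
Proof. exact/measurable_funTS/(measurableT_comp measurable_cone_density). Qed.

Lemma nu_measure : exists M : {measure set (R * R * R)%type -> \bar R},
  M = nu gamma :> (set (R * R * R) -> \bar R).
Proof.
have [M ME] := @density_measureP _ _ R lebesgue2 D (fun p => cone_density p.1) mD
  measurable_cone_density1 (fun p => cone_density_ge0 p.1).
rewrite /nu -[X in pushforward X]ME.
by unshelve refine (ex_intro _ (pushforward M cone_param :
  {measure set (R * R * R)%type -> \bar R}) _); first exact: measurable_cone_param.
Qed.

Lemma ge0_integral_nu (f : R * R * R -> \bar R) :
  measurable_fun setT f -> (forall x, (0 <= f x)%E) ->
  (\int[nu gamma]_x f x = \int[lebesgue2]_(p in `[0%R, 1%R] `*` `[0%R, (2 * pi)%R[)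
     (f (cone_param p) * (cone_density p.1)%:E))%E.
Proof.
move=> mf f0; rewrite /nu.
have [M ME] := @density_measureP _ _ R lebesgue2 D (fun p => cone_density p.1) mD
  measurable_cone_density1 (fun p => cone_density_ge0 p.1).
rewrite -[X in pushforward X]ME ge0_integral_pushforward//; last exact: measurable_cone_param.
rewrite preimage_setT ME ge0_integral_density//.
- exact: (measurableT_comp mf measurable_cone_param).
- by move=> p; exact: f0.
Qed.

Lemma ge0_integral_nu_mu (f : R * R * R -> \bar R) :
  measurable_fun setT f -> (forall x, (0 <= f x)%E) ->
  (\int[nu gamma]_x f x = \int[mu gamma]_z f (Q z))%E.
Proof.
move=> mf f0.
rewrite ge0_integral_nu// ge0_integral_mu//; last exact: (measurableT_comp mf measurable_Q).
pose h (x : R * R * R) := (f x * (cone_density x.2)%:E)%E.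
(* Only the upper bound on the height is imposed: [Q z] lies in [U] exactly when [z] is in the disk,
   and nonnegative heights come from the integration range in [ge0_integral_Q]. *)
pose U : set (R * R * R) := [set x | x.2 <= 1].
have mU : measurable U.
  rewrite (_ : U = setT `&` (fun x : R * R * R => x.2) @^-1` `]-oo, 1]).
    have m2 : measurable_fun setT (fun x : R * R * R => x.2) by exact: measurable_snd.
    by apply: m2 => //; exact: measurable_itv.
  by rewrite setTI; apply/seteqP; split => z /=; rewrite in_itv.
have mh : measurable_fun setT h.
  apply: emeasurable_funM => //; apply/measurable_EFinP.
  exact: (measurableT_comp measurable_cone_density).
have h0 x : (0 <= h x)%E by rewrite mule_ge0 ?lee_fin.
have mhU : measurable_fun setT (h \_ U).
  by apply/(measurable_restrictT _ _).1 => //; exact: measurable_funS mh.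
have hU0 x : (0 <= (h \_ U) x)%E by apply: erestrict_ge0.
transitivity (2%:E * \int[lebesgue2]_z (h \_ U) (Q z))%E; last first.
  rewrite -ge0_integralZl//; last exact: (measurableT_comp mhU measurable_Q).
  rewrite [RHS]integral_mkcond; apply: eq_integral => z _; rewrite !patchE.
  rewrite (_ : (Q z \in U) = (z \in disk)); last by apply/idP/idP; rewrite !inE.
  by case: ifPn => _; rewrite ?mule0// /h EFinM muleCA.
rewrite ge0_integral_Q// muleA -EFinM mulfV// mul1e.
rewrite [RHS]integral_mkcond [LHS]integral_mkcond.
rewrite ge0_integral_lebesgue2; first last.
- by move=> p; apply: erestrict_ge0 => q _; rewrite mule_ge0 ?lee_fin.
- apply/(measurable_restrictT _ _).1; first exact: measurableX.
  by apply: measurable_funS (measurableT_comp mh measurable_cone_param).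
apply: eq_integral => t _; rewrite [RHS]patchE; case: ifPn => t0; last first.
  rewrite integral0_eq// => phi _; rewrite patchE ifF//.
  by apply: contraNF t0; rewrite !inE/= !in_itv/= andbT => -[/andP[]].
rewrite [RHS]integral_mkcond; apply: eq_integral => phi _; rewrite !patchE.
move: t0; rewrite inE/= in_itv/= andbT => t0.
have -> : (cone_param (t, phi) \in U) = (t <= 1) by apply/idP/idP; rewrite inE.
have -> : ((t, phi) \in `[0, 1] `*` `[0, 2 * pi[) = (t <= 1) && (phi \in `[0, 2 * pi[%classic).
  by apply/idP/andP; rewrite !inE/= !in_itv/= t0 //= => -[].
by case: (t <= 1) => //=; case: ifP.
Qed.
End gamma.

End ConeDisk.

(** * Polynomial spaces *)

Section PolySpace.
Context {R : realType}.

Section closure.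
Context (T : Type) (X : set T) (n : nat) (coord : T -> 'I_n -> R).
Local Notation P := (poly_space X coord).

Lemma poly_space_eq m f g : (forall x, X x -> f x = g x) -> P m g -> P m f.
Proof. by move=> fg [p pm pE]; exists p => // x Xx; rewrite fg// pE. Qed.

Lemma poly_space_le m1 m2 f : (m1 <= m2)%N -> P m1 f -> P m2 f.
Proof. by move=> m12 [p pm pE]; exists p => //; exact: leq_trans pm _. Qed.

Lemma poly_space_cst m c : P m (fun=> c).
Proof.
exists (mpolyC n c) => [|x _]; last by rewrite mevalC.
by rewrite msizeC; case: eqP.
Qed.

Lemma poly_space_coord i : P 1 (fun x => coord x i).
Proof. by exists (mpolyX R (mnm1 i)) => [|x _]; rewrite ?mevalXU// msizeX mdeg1. Qed.

Lemma poly_space_add m f g : P m f -> P m g -> P m (fun x => f x + g x).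
Proof.
move=> [p pm pE] [q qm qE]; exists (p + q) => [|x Xx]; last by rewrite mevalD pE// qE.
by rewrite (leq_trans (msizeD_le _ _))// geq_max pm.
Qed.

Lemma poly_space_mul m1 m2 f g : P m1 f -> P m2 g ->
  P (m1 + m2) (fun x => f x * g x).
Proof.
move=> [p pm pE] [q qm qE]; exists (p * q) => [|x Xx]; last by rewrite mevalM pE// qE.
(* [msize] is the degree plus one, except that it is 0 at the zero polynomial; the formula for
   products holds for nonzero factors only. *)
have [->|p0] := eqVneq p 0; first by rewrite mul0r msize0.
have [->|q0] := eqVneq q 0; first by rewrite mulr0 msize0.
by rewrite msizeM// -subn1 (leq_trans (leq_sub2r 1 (leq_add pm qm)))// addSn addnS subn1.
Qed.

Lemma poly_space_scale m c f : P m f -> P m (fun x => c * f x).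
Proof. by move=> Pf; exact: (poly_space_mul (poly_space_cst 0 c) Pf). Qed.

Lemma poly_space_sum m (I : Type) (r : seq I) (Q : pred I) (F : I -> T -> R) :
  (forall i, Q i -> P m (F i)) -> P m (fun x => \sum_(i <- r | Q i) F i x).
Proof.
move=> PF; elim: r => [|i r IH].
  by apply: poly_space_eq (poly_space_cst m 0) => x _; rewrite big_nil.
apply: (@poly_space_eq _ _ (fun x => (if Q i then F i x else 0) +
    \sum_(j <- r | Q j) F j x)) => [x _|].
  by rewrite big_cons; case: ifP => // _; rewrite add0r.
apply: poly_space_add => //; case: (boolP (Q i)) => [/PF//|_].
exact: poly_space_cst.
Qed.

Lemma poly_space_exp m k f : P m f -> P (k * m) (fun x => f x ^+ k).
Proof.
move=> Pf; elim: k => [|k IH]; first exact: poly_space_cst.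
rewrite mulSn; apply: poly_space_eq (poly_space_mul Pf IH) => x _.
by rewrite exprS.
Qed.

Lemma poly_space_prod (I : Type) (r : seq I) (d : I -> nat) (F : I -> T -> R) :
  (forall i, P (d i) (F i)) -> P (\sum_(i <- r) d i) (fun x => \prod_(i <- r) F i x).
Proof.
move=> PF; elim: r => [|i r IH].
  by apply: poly_space_eq (poly_space_cst _ 1) => x _; rewrite big_nil.
rewrite big_cons; apply: poly_space_eq (poly_space_mul (PF i) IH) => x _.
by rewrite big_cons.
Qed.

End closure.

Lemma poly_space_comp (S T : Type) (Y : set S) (X : set T) n n'
    (coord : T -> 'I_n -> R) (coord' : S -> 'I_n' -> R) (phi : S -> T) d m f :
  (forall y, Y y -> X (phi y)) ->
  (forall i, poly_space Y coord' d (fun y => coord (phi y) i)) ->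
  poly_space X coord m f -> poly_space Y coord' (m * d) (f \o phi).
Proof.
move=> YX Pphi [p pm pE].
(* [poly_space_sum] wants the degree bound for every index, not only for those in the support; the
   guard provides it without changing the sum. *)
apply: (@poly_space_eq _ _ _ _ _ _ (fun y => \sum_(a <- msupp p)
    (if (mdeg a <= m)%N then mcoeff a p * \prod_i coord (phi y) i ^+ a i else 0))).
  move=> y /YX /pE /= ->; rewrite mevalE big_seq [RHS]big_seq; apply: eq_bigr => a ap.
  by rewrite ifT// -ltnS (leq_trans _ pm)// msize_mdeg_lt.
apply: poly_space_sum => a _; case: (boolP (mdeg a <= m)%N) => [am|_];
  last exact: poly_space_cst.
apply: poly_space_scale.
apply: (@poly_space_le _ _ _ _ (\sum_(i < n) a i * d)).
  by rewrite -big_distrl/= leq_mul2r -mdegE am orbT.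
by apply: poly_space_prod => i; exact: poly_space_exp.
Qed.

End PolySpace.

Section PiQ.
Context {R : realType}.
Implicit Types z : R * R.

Lemma disk_opp z : disk z -> disk (- z).
Proof. by rewrite /disk/= !sqrrN. Qed.

Lemma Q_opp z : Q (- z) = Q z.
Proof. by rewrite /Q/= !sqrrN !mulrN !mulNr opprK. Qed.

Lemma PiB_fst : PiB 1 (fun z : R * R => z.1).
Proof. exact: (@poly_space_coord R _ disk _ (fun z : R * R => tnth [tuple z.1; z.2]) ord0). Qed.

Lemma PiB_snd : PiB 1 (fun z : R * R => z.2).
Proof. exact: (@poly_space_coord R _ disk _ (fun z : R * R => tnth [tuple z.1; z.2]) ord_max). Qed.

Let coordV (x : R * R * R) := tnth [tuple x.1.1; x.1.2; x.2].

Lemma PiV_fst : PiV 1 (fun x : R * R * R => x.1.1).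
Proof. exact: (@poly_space_coord R _ cone _ coordV ord0). Qed.

Lemma PiV_snd : PiV 1 (fun x : R * R * R => x.1.2).
Proof. exact: (@poly_space_coord R _ cone _ coordV (lift ord0 ord0)). Qed.

Lemma PiV_thd : PiV 1 (fun x : R * R * R => x.2).
Proof. exact: (@poly_space_coord R _ cone _ coordV ord_max). Qed.

Lemma PiB_comp_opp m (F : R * R -> R) : PiB m F -> PiB m (F \o -%R).
Proof.
move=> PF; rewrite -[m]muln1.
apply: (poly_space_comp _ _ PF) => [y|]; first exact: disk_opp.
case=> -[|[|//]] i2.
  by apply: (poly_space_eq _ (poly_space_scale (-1) PiB_fst)) => z _; rewrite (tnth_nth 0)/= mulN1r.
by apply: (poly_space_eq _ (poly_space_scale (-1) PiB_snd)) => z _; rewrite (tnth_nth 0)/= mulN1r.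
Qed.

Lemma PiB_comp_Q m (f : R * R * R -> R) : PiV m f -> PiB (2 * m) (f \o Q).
Proof.
move=> Pf; rewrite mulnC; apply: (poly_space_comp _ _ Pf) => [z|].
  by rewrite /disk/cone/=; move=> z1; split; [ring|rewrite z1 addr_ge0 ?sqr_ge0].
have sq1 := poly_space_exp 2 PiB_fst; have sq2 := poly_space_exp 2 PiB_snd.
case=> -[|[|[|//]]] i2.
- apply: (poly_space_eq _ (poly_space_add sq1 (poly_space_scale (-1) sq2))) => z _.
  by rewrite (tnth_nth 0)/= mulN1r.
- apply: (poly_space_eq _ (poly_space_mul (poly_space_scale 2 PiB_fst) PiB_snd)) => z _.
  by rewrite (tnth_nth 0).
- by apply: (poly_space_eq _ (poly_space_add sq1 sq2)) => z _; rewrite (tnth_nth 0).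
Qed.

(* On [Q z]: [(x + t) / 2 = u ^ 2], [(t - x) / 2 = v ^ 2] and [y / 2 = u v]. *)
Let monomial_cone (i j : nat) (x : R * R * R) :=
  (if odd i then 2^-1 * x.1.2 else 1) *
  ((2^-1 * (x.1.1 + x.2)) ^+ i./2 * (2^-1 * (x.2 + -1 * x.1.1)) ^+ j./2).

(** [i] and [j] have the same parity. If both are odd, one factor [u v] is split off as [y / 2];
    what remains is a product of powers of [u ^ 2] and [v ^ 2]. *)
Let monomial_coneE i j z : ~~ odd (i + j) ->
  monomial_cone i j (Q z) = z.1 ^+ i * z.2 ^+ j.
Proof.
rewrite oddD /monomial_cone /Q/= => oij.
rewrite (_ : 2^-1 * (z.1 ^+ 2 - z.2 ^+ 2 + (z.1 ^+ 2 + z.2 ^+ 2)) = z.1 ^+ 2); last by field.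
rewrite (_ : 2^-1 * (z.1 ^+ 2 + z.2 ^+ 2 + -1 * (z.1 ^+ 2 - z.2 ^+ 2)) = z.2 ^+ 2); last by field.
rewrite -!exprM -[in RHS](odd_double_half i) -[in RHS](odd_double_half j) -!mul2n !exprD.
move: oij; case: (odd i); case: (odd j) => // _; last by rewrite !expr0 !mul1r.
by rewrite !expr1; field.
Qed.

(** Each of [u v], [u ^ 2], [v ^ 2] has degree 2 on the disk and is linear on the cone, so the
    degree is halved. *)
Let PiV_monomial_cone i j n : ~~ odd (i + j) -> (i + j <= 2 * n)%N ->
  PiV n (monomial_cone i j).
Proof.
rewrite oddD => oij ijn.
have P1 : PiV 1 (fun x : R * R * R => 2^-1 * (x.1.1 + x.2)).
  exact: poly_space_scale (poly_space_add PiV_fst PiV_thd).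
have P2 : PiV 1 (fun x : R * R * R => 2^-1 * (x.2 + -1 * x.1.1)).
  exact: poly_space_scale (poly_space_add PiV_thd (poly_space_scale _ PiV_fst)).
have P0 : PiV (odd i) (fun x : R * R * R => if odd i then 2^-1 * x.1.2 else 1).
  by case: (odd i); [exact: poly_space_scale PiV_snd|exact: poly_space_cst].
have := poly_space_mul P0 (poly_space_mul (poly_space_exp i./2 P1) (poly_space_exp j./2 P2)).
apply: poly_space_le; rewrite !muln1 -(leq_pmul2l (isT : 0 < 2)%N) (leq_trans _ ijn)//.
rewrite -[X in (_ <= X + _)%N]odd_double_half -[X in (_ <= _ + X)%N]odd_double_half.
by move: oij; case: (odd i); case: (odd j) => // _; rewrite -!mul2n !mulnDr; lia.
Qed.

Lemma PiB_even n (F : R * R -> R) : PiB (2 * n) F ->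
  (forall z, disk z -> F (- z) = F z) ->
  exists2 f, PiV n f & forall z, disk z -> F z = f (Q z).
Proof.
move=> [p pm pE] Feven.
pose i0 : 'I_2 := ord0; pose i1 : 'I_2 := ord_max.
exists (fun x => \sum_(a <- msupp p)
  if (a i0 + a i1 <= 2 * n)%N && ~~ odd (a i0 + a i1)
  then mcoeff a p * monomial_cone (a i0) (a i1) x else 0).
  apply: poly_space_sum => a _; case: (boolP (_ && _)) => [/andP[an ao]|_];
    last exact: poly_space_cst.
  exact/poly_space_scale/PiV_monomial_cone.
have FE z : disk z -> F z = \sum_(a <- msupp p) mcoeff a p * (z.1 ^+ a i0 * z.2 ^+ a i1).
  move=> /pE ->; rewrite mevalE; apply: eq_bigr => a _.
  by rewrite big_ord_recl big_ord1 !(tnth_nth 0)/=; congr (_ * (_ * _ ^+ a _)); apply: val_inj.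
(* The polynomial representing [F] may contain odd monomials; averaging over [z] and [- z] cancels
   them. *)
move=> z dz; transitivity (2^-1 * (F z + F (- z))).
  by rewrite Feven//; field.
rewrite !FE//; last exact: disk_opp.
rewrite -big_split mulr_sumr/= big_seq [RHS]big_seq; apply: eq_bigr => a ap.
have -> : (a i0 + a i1 <= 2 * n)%N.
  rewrite -ltnS (leq_trans _ pm)//; have := msize_mdeg_lt ap.
  rewrite mdegE big_ord_recl big_ord1; congr (_ + a _ < _)%N.
  exact: val_inj.
rewrite /= (exprNn z.1) (exprNn z.2) mulrACA -exprD -signr_odd.
case: (boolP (odd _)) => ao /=; first by rewrite expr1 mulN1r mulrN subrr mulr0.
by rewrite monomial_coneE// expr0 mul1r; field.
Qed.
End PiQ.

(** * Integrals of polynomials *)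

Section PolyInt.
Context {R : realType}.

Lemma poly_space_measurable d (T : measurableType d) (X : set T) n
    (coord : T -> 'I_n -> R) m f :
  (forall i, measurable_fun setT (coord^~ i)) -> poly_space X coord m f ->
  exists2 g, measurable_fun setT g & forall x, X x -> f x = g x.
Proof.
move=> mcoord [p _ pE]; exists (fun x => meval (coord x) p) => //.
under eq_fun do rewrite mevalE.
apply: measurable_sum => a; apply: measurable_funM => //.
by apply: measurable_prod => i _; exact: measurable_funX.
Qed.

Lemma poly_space_bounded (T : Type) (X : set T) n (coord : T -> 'I_n -> R) m f :
  (forall x i, X x -> `|coord x i| <= 1) -> poly_space X coord m f ->
  exists M, forall x, X x -> `|f x| <= M.
Proof.
move=> coord1 [p _ pE]; exists (\sum_(a <- msupp p) `|mcoeff a p|) => x Xx.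
rewrite pE// mevalE (le_trans (ler_norm_sum _ _ _))//; apply: ler_sum => a _.
rewrite normrM ler_piMr// normr_prod; apply: prodr_ile1 => i _.
by rewrite normr_ge0/= normrX exprn_ile1// coord1.
Qed.

Lemma PiV_measurable m (f : R * R * R -> R) : PiV m f ->
  exists2 g, measurable_fun setT g & forall x, cone x -> f x = g x.
Proof.
apply: poly_space_measurable => -[[|[|[|//]]] i2].
- by under eq_fun do rewrite (tnth_nth 0)/=; exact: measurableT_comp.
- by under eq_fun do rewrite (tnth_nth 0)/=; exact: measurableT_comp.
- by under eq_fun do rewrite (tnth_nth 0)/=; exact: measurable_snd.
Qed.

Lemma PiB_measurable m (f : R * R -> R) : PiB m f ->
  exists2 g, measurable_fun setT g & forall x, disk x -> f x = g x.
Proof.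
apply: poly_space_measurable => -[[|[|//]] i2].
- by under eq_fun do rewrite (tnth_nth 0)/=; exact: measurable_fst.
- by under eq_fun do rewrite (tnth_nth 0)/=; exact: measurable_snd.
Qed.

Lemma PiB_bounded m (f : R * R -> R) : PiB m f ->
  exists M, forall x, disk x -> `|f x| <= M.
Proof.
apply: poly_space_bounded => -[u v] i; rewrite /disk/= => uv.
have norm1 (x y : R) : x ^+ 2 + y ^+ 2 <= 1 -> `|x| <= 1.
  move=> xy; rewrite -(@ler_pXn2r _ 2)// ?nnegrE// real_normK ?num_real// expr1n.
  by rewrite (le_trans _ xy)// lerDl sqr_ge0.
case: i => -[|[|//]] i2; rewrite (tnth_nth 0)/=; first exact: norm1 uv.
by apply: (norm1 _ u); rewrite addrC.
Qed.

Section gamma.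
Variable gamma : R.
Hypothesis gamma1 : -1 < gamma.

Lemma integral_nu_mu m (f : R * R * R -> R) : PiV m f ->
  (\int[nu gamma]_(x in cone) (f x)%:E = \int[mu gamma]_(z in disk) (f (Q z))%:E)%E.
Proof.
have [MV MVE] := nu_measure gamma1; have [MB MBE] := mu_measure gamma1.
have H (g : R * R * R -> \bar R) : measurable_fun setT g -> (forall x, (0 <= g x)%E) ->
    (\int[nu gamma]_(x in cone) g x = \int[mu gamma]_(z in disk) g (Q z))%E.
  move=> mg g0; rewrite -MVE -MBE integral_mkcond [RHS]integral_mkcond MVE.
  rewrite ge0_integral_nu_mu//.
  - rewrite -MBE; apply: eq_integral => z _; rewrite !patchE.
    have -> : (Q z \in cone) = (z \in disk) by apply/idP/idP; rewrite !inE cone_Q.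
    by [].
  - apply/(measurable_restrictT _ _).1; first exact: measurable_cone.
    exact: measurable_funS mg.
  - by move=> x; apply: erestrict_ge0.
move=> /PiV_measurable[g mg fg]; move: H; rewrite -MVE -MBE => H.
rewrite (eq_integral (EFin \o g)); last by move=> x; rewrite inE => /fg ->.
rewrite [RHS](eq_integral (EFin \o g \o Q)); last first.
  by move=> z; rewrite inE => dz /=; rewrite fg//; exact/cone_Q.
have mEg : measurable_fun setT (EFin \o g) by exact/measurable_EFinP.
(* Positive and negative parts agree separately in the extended reals, so the transfer holds without
   any integrability. *)
rewrite integralE [RHS]integralE; congr (_ - _)%E.
- rewrite (H _ (measurable_funepos mEg) (funepos_ge0 _)).
  by apply: eq_integral => z _; rewrite !funeposE.
- rewrite (H _ (measurable_funeneg mEg) (funeneg_ge0 _)).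
  by apply: eq_integral => z _; rewrite !funenegE.
Qed.

(** Lebesgue measure, the disk and the density are all invariant under [z -> - z]. *)
Lemma integral_mu_opp m (f : R * R -> R) : PiB m f ->
  (\int[mu gamma]_(z in disk) (f (- z))%:E = \int[mu gamma]_(z in disk) (f z)%:E)%E.
Proof.
have [mopp iopp] := @preserves_lebesgue2_opp R; have [MB MBE] := mu_measure gamma1.
have H (g : R * R -> \bar R) : measurable_fun setT g -> (forall x, (0 <= g x)%E) ->
    (\int[mu gamma]_(z in disk) g (- z)%R = \int[mu gamma]_(z in disk) g z)%E.
  move=> mg g0; rewrite -MBE integral_mkcond [RHS]integral_mkcond.
  have mgd : measurable_fun setT (g \_ disk).
    apply/(measurable_restrictT _ _).1; first exact: measurable_disk.
    exact: measurable_funS mg.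
  have gd0 z : (0 <= (g \_ disk) z)%E by apply: erestrict_ge0.
  have E z : ((fun z => g (- z)%R) \_ disk) z = (g \_ disk) (- z).
    rewrite !patchE; congr (if _ then _ else _); apply/idP/idP; rewrite !inE.
      exact: disk_opp.
    by rewrite -{2}(opprK z); exact: disk_opp.
  under eq_integral do rewrite E.
  rewrite MBE ge0_integral_mu//; last exact: (measurableT_comp mgd mopp).
  rewrite ge0_integral_mu// integral_mkcond [RHS]integral_mkcond.
  pose w z := ((g \_ disk) z * (2 * cone_density gamma (normsq z))%:E)%E.
  have mw : measurable_fun disk w.
    apply/measurable_funTS/emeasurable_funM => //; apply/measurable_EFinP/measurable_funM => //.
    exact: (measurableT_comp (measurable_cone_density gamma) measurable_normsq).
  rewrite -[RHS](iopp (w \_ disk)).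
  - apply: eq_integral => z _; rewrite !patchE /w/= /normsq/= !sqrrN.
    congr (if _ then _ else _); apply/idP/idP; rewrite !inE; first exact: disk_opp.
    by rewrite -{2}(opprK z); exact: disk_opp.
  - by apply/(measurable_restrictT _ _).1 => //; exact: measurable_disk.
  - move=> z; apply: erestrict_ge0 => ? _.
    by rewrite mule_ge0// lee_fin mulr_ge0// cone_density_ge0.
move=> /PiB_measurable[g mg fg]; move: H; rewrite -MBE => H.
rewrite (eq_integral (EFin \o g \o -%R)); last first.
  by move=> z; rewrite inE => /disk_opp dz/=; rewrite fg.
rewrite [RHS](eq_integral (EFin \o g)); last by move=> z; rewrite inE => /fg ->.
have mEg : measurable_fun setT (EFin \o g) by exact/measurable_EFinP.
rewrite integralE [RHS]integralE; congr (_ - _)%E.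
- rewrite -(H _ (measurable_funepos mEg) (funepos_ge0 _)).
  by apply: eq_integral => z _; rewrite !funeposE.
- rewrite -(H _ (measurable_funeneg mEg) (funeneg_ge0 _)).
  by apply: eq_integral => z _; rewrite !funenegE.
Qed.

(** Polynomials are bounded on the disk. This supplies the finiteness under which [fine] is
    additive. *)
Lemma integrable_PiB (M : {measure set (R * R) -> \bar R}) m (f : R * R -> R) :
  (M disk < +oo)%E -> PiB m f -> M.-integrable disk (EFin \o f).
Proof.
move=> Mfin Pf; have [g mg fg] := PiB_measurable Pf; have [B fB] := PiB_bounded Pf.
apply: (@eq_integrable _ _ _ _ _ measurable_disk (EFin \o g)).
  by move=> z; rewrite inE => /fg /= ->.
apply: measurable_bounded_integrable => //; first exact: measurable_disk.
  exact: measurable_funTS.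
exists B; split; first exact: num_real.
by move=> x Bx z dz /=; rewrite -fg// (le_trans (fB _ dz))// ltW.
Qed.

End gamma.
End PolyInt.

(** * Reproducing kernels *)

Section Kernel.
Context {R : realType}.
Variable gamma : R.
Hypothesis gamma1 : -1 < gamma.
Variables (n : nat) (KV : R * R * R -> R * R * R -> R) (KB : R * R -> R * R -> R).
Hypothesis rKV : reproducing_kernel (nu gamma) cone (PiV n) KV.
Hypothesis rKB : reproducing_kernel (mu gamma) disk (PiB (2 * n)) KB.

Let PiB_KB w : disk w -> PiB (2 * n) (KB^~ w).
Proof. by move=> /rKB[]. Qed.

Let KB_reproduces F w : PiB (2 * n) F -> disk w ->
  F w = fine (\int[mu gamma]_(x in disk) (F x * KB x w)%:E)%E.
Proof. by move=> PF /rKB[_]; exact. Qed.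

(** Reproducing [KB^~ w] at [z] and [KB^~ z] at [w] yields the same integral. *)
Lemma KB_sym z w : disk z -> disk w -> KB z w = KB w z.
Proof.
move=> dz dw; rewrite (KB_reproduces (PiB_KB dw) dz) (KB_reproduces (PiB_KB dz) dw).
by under eq_fun do rewrite mulrC.
Qed.

(** After symmetry both sides are values of reflected kernel sections; reproducing them gives two
    integrals that differ by [x -> - x]. *)
Lemma KB_opp z w : disk z -> disk w -> KB (- z) w = KB z (- w).
Proof.
move=> dz dw; rewrite (KB_sym dz (disk_opp dw)).
rewrite [LHS](KB_reproduces (PiB_comp_opp (PiB_KB dw)) dz).
rewrite [RHS](KB_reproduces (PiB_comp_opp (PiB_KB dz)) dw)/=.
have P : PiB (2 * n + 2 * n) (fun x => KB x z * KB (- x) w).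
  exact: poly_space_mul (PiB_KB dz) (PiB_comp_opp (PiB_KB dw)).
under eq_fun do rewrite mulrC.
rewrite -(integral_mu_opp gamma1 P).
by under eq_fun do rewrite opprK.
Qed.

(** The even function [KB^~ z + KB^~ (- z)] descends to some [h] on the cone. The integral of [h]
    against [KV^~ (Q w)] is [h (Q w)]; pulled back to the disk it is the integral of [g] against the
    two sections of [KB], that is [g z + g (- z) = 2 * KV (Q z) (Q w)]. *)
Lemma KV_Q z w : (mu gamma disk < +oo)%E -> disk z -> disk w ->
  KV (Q z) (Q w) = 2^-1 * (KB z w + KB z (- w)).
Proof.
move=> mufin dz dw; have dNz := disk_opp dz; have cw : cone (Q w) by exact/cone_Q.
pose g x := KV (Q x) (Q w); have [PKw KwE] := rKV cw.
have Pg : PiB (2 * n) g by exact: PiB_comp_Q PKw.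
have Ph : PiB (2 * n) (fun x => KB x z + KB x (- z)).
  by apply: poly_space_add; exact: PiB_KB.
have [|h Ph' hE] := PiB_even Ph.
  by move=> x dx; rewrite !KB_opp// opprK addrC.
have int u : disk u -> forall M : {measure set (R * R) -> \bar R},
    M = mu gamma :> (set (R * R) -> \bar R) ->
    M.-integrable disk (EFin \o (fun x => g x * KB x u)).
  move=> du M ME; apply: integrable_PiB; first by rewrite ME.
  exact: poly_space_mul Pg (PiB_KB du).
have [M ME] := mu_measure gamma1.
have : g z + g (- z) = h (Q w).
  rewrite KwE// (integral_nu_mu gamma1 (poly_space_mul Ph' PKw)).
  rewrite (KB_reproduces Pg dz) (KB_reproduces Pg dNz) -ME.
  rewrite -fineD; last 2 first.
  - exact: (integrable_fin_num measurable_disk (int _ dz _ ME)).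
  - exact: (integrable_fin_num measurable_disk (int _ dNz _ ME)).
  rewrite -(integralD_EFin measurable_disk (int _ dz _ ME) (int _ dNz _ ME)).
  congr fine; apply: eq_integral => x; rewrite inE => dx.
  by rewrite -hE// -EFinD -mulrDr mulrC.
rewrite -hE// /g Q_opp -!(KB_sym dw)// KB_sym// [KB w (- z)]KB_sym// KB_opp// => <-.
by field.
Qed.

End Kernel.

(** * Continuous functions on the cone *)

Section Norms.
Context {R : realType}.

(** A complex square root: half the angle and the root of the height. *)
Lemma Q_surj (x : R * R * R) : cone x -> exists2 z, disk z & Q z = x.
Proof.
case: x => -[x y] t; rewrite /cone/= => -[xyt /andP[t0 t1]].
have [phi _ [xE yE]] := polar_angle t0 xyt.
exists (Num.sqrt t * cos (phi / 2), Num.sqrt t * sin (phi / 2)).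
  by rewrite /disk/= !exprMn -mulrDr cos2Dsin2 mulr1 sqr_sqrtr.
have ph : phi = phi / 2 + phi / 2 by field.
rewrite /Q/= !exprMn -mulrDr -mulrBr cos2Dsin2 mulr1 sqr_sqrtr// xE yE.
congr (_, _, _); first by rewrite [in RHS]ph cosD -!expr2.
by rewrite [in RHS]ph sinD -[in RHS](sqr_sqrtr t0); ring.
Qed.

(** From [|w - z|^2 |w + z|^2 = |w^2 - z^2|^2], one factor on the left vanishes. *)
Lemma Q_inj_opp (z w : R * R) : Q z = Q w -> w = z \/ w = - z.
Proof.
case: z w => [z1 z2] [w1 w2]; rewrite /Q/= => -[e1 e2 _].
have : ((w1 - z1) ^+ 2 + (w2 - z2) ^+ 2) * ((w1 + z1) ^+ 2 + (w2 + z2) ^+ 2) = 0.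
  transitivity (((z1 ^+ 2 - z2 ^+ 2) - (w1 ^+ 2 - w2 ^+ 2)) ^+ 2 +
    (2 * z1 * z2 - 2 * w1 * w2) ^+ 2); first by ring.
  by rewrite e1 e2 !subrr expr0n addr0.
move=> /eqP; rewrite mulf_eq0 !paddr_eq0 ?sqr_ge0// !sqrf_eq0.
move=> /orP[]/andP[]; rewrite ?subr_eq0 ?addr_eq0 => /eqP-> /eqP->; [by left|by right].
Qed.

Lemma continuous_Q : continuous (@Q R).
Proof.
move=> z; have c1 : (fun z : R * R => z.1) @ z --> z.1 by exact: cvg_fst.
have c2 : (fun z : R * R => z.2) @ z --> z.2 by exact: cvg_snd.
have cX : (fun z : R * R => z.1 ^+ 2 - z.2 ^+ 2) @ z --> z.1 ^+ 2 - z.2 ^+ 2.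
  exact: (cvgB (cvgM c1 c1) (cvgM c2 c2)).
have cY : (fun z : R * R => 2 * z.1 * z.2) @ z --> 2 * z.1 * z.2.
  by apply: (cvgM _ c2); apply: (cvgM _ c1); exact: cvg_cst.
have cT : (fun z : R * R => z.1 ^+ 2 + z.2 ^+ 2) @ z --> z.1 ^+ 2 + z.2 ^+ 2.
  exact: (cvgD (cvgM c1 c1) (cvgM c2 c2)).
exact: (cvg_pair (cvg_pair cX cY) cT).
Qed.

Lemma Cspace_comp_Q (f : R * R * R -> R) : Cspace cone f -> Cspace disk (f \o Q).
Proof.
move=> /subspace_continuousP cf; apply/subspace_continuousP => z dz.
have cz : cone (Q z) by exact/cone_Q.
move=> U /(cf _ cz) /(@continuous_Q z) zU.
suff : nbhs z (fun w => disk w -> U (f (Q w))) by [].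
by apply: (@filterS _ (nbhs z) _ _ _ _ zU) => w wU dw; apply: wU; exact/cone_Q.
Qed.

(** If [Q w] is close to [Q z], then [w] or [- w] is close to [z], and [f \o Q] takes the same value
    at both. *)
Lemma Cspace_descend (f : R * R * R -> R) : Ceven (f \o Q) -> Cspace cone f.
Proof.
move=> [/subspace_continuousP cF _]; apply/subspace_continuousP => x.
move=> /Q_surj[z dz <-{x}] U /(cF _ dz) /nbhs_ballP[e/= e0 zU].
(* Balls are coordinatewise. If [w] and [- w] both miss the [e]-ball at [z], the product of squared
   distances is at least [e ^ 4], whereas this radius bounds the sum of two squares by
   [e ^ 4 / 2]. *)
apply/nbhs_ballP; exists (e ^+ 2 / 2) => /=; first by rewrite divr_gt0// exprn_gt0.
move=> y zy /Q_surj[w dw wy]; move: zy; rewrite -{}wy => zw.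
have [zwe|zwe] := pselect (ball z e w); first exact: zU.
have [zwe'|zwe'] := pselect (ball z e (- w)).
  by have : U (f (Q (- w))) := zU _ zwe' (disk_opp dw); rewrite Q_opp.
have far (u : R * R) : ~ ball z e u -> e ^+ 2 <= (z.1 - u.1) ^+ 2 + (z.2 - u.2) ^+ 2.
  move=> /not_andP; rewrite /ball/= => zu.
  have sq (v : R) : ~ `|v| < e -> e ^+ 2 <= v ^+ 2.
    by move=> /negP; rewrite -leNgt -[v ^+ 2]real_normK ?num_real// ler_sqr ?nnegrE// ltW.
  by case: zu => /sq /le_trans; apply; rewrite ?lerDl ?lerDr sqr_ge0.
have [[zw1 zw2] _] := zw; move: zw1 zw2; rewrite /ball/= => zw1 zw2.
have bound (v : R) : `|v| < e ^+ 2 / 2 -> v ^+ 2 < e ^+ 4 / 4.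
  move=> ve; rewrite -[v ^+ 2]real_normK ?num_real//.
  rewrite (_ : e ^+ 4 / 4 = (e ^+ 2 / 2) ^+ 2); last by field.
  by rewrite ltr_sqr ?nnegrE// divr_ge0// exprn_ge0// ltW.
(* As complex numbers, |z - w| |z + w| = |z^2 - w^2|. *)
have : e ^+ 4 <= ((z.1 - w.1) ^+ 2 + (z.2 - w.2) ^+ 2) * ((z.1 + w.1) ^+ 2 + (z.2 + w.2) ^+ 2).
  have := far _ zwe'; rewrite /= !opprK => le2.
  rewrite (_ : e ^+ 4 = e ^+ 2 * e ^+ 2); last by ring.
  by apply: ler_pM => //; [exact: exprn_ge0 (ltW e0)|exact: exprn_ge0 (ltW e0)|exact: far].
rewrite (_ : _ * _ = (z.1 ^+ 2 - z.2 ^+ 2 - (w.1 ^+ 2 - w.2 ^+ 2)) ^+ 2 +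
    (2 * z.1 * z.2 - 2 * w.1 * w.2) ^+ 2); last by ring.
have := bound _ zw1; have := bound _ zw2; have := exprn_gt0 4 e0; lra.
Qed.

End Norms.

(** * Lifting *)

Section Lifting.
Context {R : realType}.

(* Exactness on the constant 1 makes the positive sum of the weights equal to
   [fine] of the total mass, and [fine +oo = 0]. *)
Lemma positive_cubature_mu_disk (gamma : R) n (rule : seq (R * R * R * R)) q :
  -1 < gamma -> positive_cubature (nu gamma) cone (PiV n) rule ->
  q \in rule -> (mu gamma disk < +oo)%E.
Proof.
move=> gamma1 [_ pos exact_rule] qrule; have P1 : PiV n (fun=> 1 : R) := poly_space_cst _ _ _ _.
have [M ME] := mu_measure gamma1.
have := exact_rule _ P1; rewrite (integral_nu_mu gamma1 P1) -ME.
rewrite (integral_cst M measurable_disk 1%E) mul1e => E.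
rewrite ltey; apply: contraTneq isT => Minf; move: E; rewrite Minf/= => /eqP.
rewrite (big_rem q)//= mulr1 gt_eqF// ltr_wpDr//; last by case: (pos _ qrule).
rewrite big_seq sumr_ge0// => r /mem_rem/pos[_ /ltW]; by rewrite mulr1.
Qed.

Section kernel_op.
Variables (gamma : R) (n : nat) (KV : R * R * R -> R * R * R -> R)
  (KB : R * R -> R * R -> R) (rule : seq (R * R * R * R)) (s : R * R * R -> R * R).
Hypotheses (gamma1 : -1 < gamma)
  (rKV : reproducing_kernel (nu gamma) cone (PiV n) KV)
  (rKB : reproducing_kernel (mu gamma) disk (PiB (2 * n)) KB)
  (cub : positive_cubature (nu gamma) cone (PiV (2 * n)) rule)
  (choice_s : preimage_choice s rule).

Lemma kernel_op_lifted_rule (f : R * R * R -> R) (F : R * R -> R) z :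
  (forall z, disk z -> F z = f (Q z)) -> disk z ->
  kernel_op rule KV f (Q z) = kernel_op (lifted_rule s rule) KB F z.
Proof.
move=> Ff dz; rewrite /kernel_op big_flatten big_map/= big_seq [RHS]big_seq.
apply: eq_bigr => q qrule; have [ds Qs] := choice_s qrule.
have mufin := positive_cubature_mu_disk gamma1 cub qrule.
have KVE := KV_Q gamma1 rKV rKB mufin dz.
(* At the apex the two preimages coincide, so both halves of the kernel average fall on the origin,
   which carries the full weight; elsewhere each preimage takes one half. *)
rewrite /lift_node; case: eqP => [q0|_].
  have d0 : disk (0 : R * R) by rewrite /disk/= expr0n/= addr0 ler01.
  have Q0 : Q 0 = 0 :> R * R * R by rewrite /Q/= expr0n/= subrr addr0 mulr0.
  by rewrite big_seq1/= q0 Ff// Q0 -[in KV _ _]Q0 KVE// oppr0; field.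
rewrite big_cons big_seq1/= !Ff ?Q_opp//; last exact: disk_opp.
by rewrite -[in KV _ _]Qs KVE// Qs; field.
Qed.

Let LV := kernel_op rule KV.
Let HB := kernel_op (lifted_rule s rule) KB.

Lemma uniform_norm_lifted_rule f F : (forall z, disk z -> F z = f (Q z)) ->
  uniform_norm cone (LV f) = uniform_norm disk (HB F).
Proof.
move=> Ff; congr ereal_sup; apply/seteqP; split => y /=.
  move=> [x /Q_surj[z dz <-] <-]; exists z => //.
  by rewrite /LV (kernel_op_lifted_rule Ff).
move=> [z dz <-]; exists (Q z); first exact/cone_Q.
by rewrite /LV (kernel_op_lifted_rule Ff).
Qed.

Lemma uniform_norm_comp_Q (f : R * R * R -> R) (F : R * R -> R) :
  (forall z, disk z -> F z = f (Q z)) -> uniform_norm cone f = uniform_norm disk F.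
Proof.
move=> Ff; congr ereal_sup; apply/seteqP; split => y /=.
  by move=> [x /Q_surj[z dz <-] <-]; exists z => //; rewrite Ff.
by move=> [z dz <-]; exists (Q z); [exact/cone_Q|rewrite Ff].
Qed.

(** The two suprema run over the same set of values: [f] corresponds to [f \o Q], and an even [F] to
    its descent to the cone. *)
Lemma operator_norm_lifted_rule :
  operator_norm (Cspace cone) cone cone LV = operator_norm Ceven disk disk HB.
Proof.
congr ereal_sup; apply/seteqP; split => y /=.
  move=> [f [Cf f1] <-]; have fQ z : disk z -> (f \o Q) z = f (Q z) by [].
  exists (f \o Q); last by rewrite (uniform_norm_lifted_rule fQ).
  rewrite -(uniform_norm_comp_Q fQ); split=> //; split; first exact: Cspace_comp_Q.
  by move=> z _ /=; rewrite Q_opp.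
move=> [F [[CF Feven] F1] <-].
(* An arbitrary section of [Q], possibly discontinuous. Evenness of [F] makes the choice immaterial,
   and [F \o sect] is continuous on the cone because its pull-back agrees with [F] on the disk. *)
pose sect (x : R * R * R) := xget 0 [set z | disk z /\ Q z = x].
have sectP z : disk z -> disk (sect (Q z)) /\ Q (sect (Q z)) = Q z.
  by move=> dz; apply: (xgetPex 0 (P := [set w | disk w /\ Q w = Q z])); exists z.
have fQ z : disk z -> F z = (F \o sect) (Q z).
  move=> dz /=; have [_ /esym /Q_inj_opp[->//|->]] := sectP _ dz.
  by rewrite Feven.
exists (F \o sect); last by rewrite (uniform_norm_lifted_rule fQ).
rewrite (uniform_norm_comp_Q fQ); split => //.
apply: Cspace_descend; split; last by move=> z _; rewrite /= Q_opp.
move: CF => /subspace_continuousP CF; apply/subspace_continuousP => z dz.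
move=> U zU; have {zU} : nbhs (F z) U by rewrite fQ.
move=> /(CF _ dz) zU.
suff : nbhs z (fun w => disk w -> U ((F \o sect) (Q w))) by [].
by apply: (@filterS _ (nbhs z) _ _ _ _ zU) => w wU dw; rewrite -fQ//; exact: wU.
Qed.

End kernel_op.
End Lifting.

Theorem theorem5p2 (R : realType) (gamma : R) (n : nat)
    (KV : R * R * R -> R * R * R -> R) (KB : R * R -> R * R -> R)
    (rule : seq (R * R * R * R)) (s : R * R * R -> R * R) :
  -1 < gamma ->
  reproducing_kernel (nu gamma) cone (PiV n) KV ->
  reproducing_kernel (mu gamma) disk (PiB (2 * n)) KB ->
  positive_cubature (nu gamma) cone (PiV (2 * n)) rule ->
  preimage_choice s rule ->
  let LV := kernel_op rule KV in
  let HB := kernel_op (lifted_rule s rule) KB in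
  [/\ forall (f : R * R * R -> R) (F : R * R -> R),
        Cspace cone f -> (forall z, disk z -> F z = f (Q z)) ->
        (forall z, disk z -> LV f (Q z) = HB F z) /\
        (forall z, disk z -> HB F (- z) = HB F z),
      operator_norm (Cspace cone) cone cone LV =
        operator_norm Ceven disk disk HB &
      (operator_norm Ceven disk disk HB <=
        operator_norm (Cspace disk) disk disk HB)%E].
Proof.
move=> gamma1 rKV rKB cub choice_s LV HB.
have lift f F z := @kernel_op_lifted_rule R gamma n KV KB rule s gamma1 rKV rKB cub choice_s f F z.
split.
- move=> f F _ Ff; split=> z dz; first exact: lift.
  (* Evenness follows from the lifting identity: the value depends on [z] only through [Q z]. *)
  by rewrite /HB -(lift f)//; [rewrite Q_opp (lift f F)|exact: disk_opp].
- exact: operator_norm_lifted_rule gamma1 rKV rKB cub choice_s.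
- by apply: ereal_sup_le => _ [F [[CF _] F1] <-]; exists F.
Qed.
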